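(* Let $(X_\alpha)_{\alpha\in A}$ be a family of singular $(G,X)$ model spaces (connected singular $(G,X)$-manifolds, with $\mathrm{Reg}(X_\alpha)$ semi-locally simply connected) and let $M$ be a connected $X_A$-manifold. Assume that $\mathrm{Reg}(M)$ is semi-locally simply connected and that each $X_\alpha$ admits a developing map $\widetilde{X_\alpha}\to X$. Let $S\subset M$ be a skeletal subset such that $S\supset\mathrm{Sing}(M)$ and $M\setminus S$ is semi-locally simply connected. Then $\widetilde M^S\to M$ admits a developing map $\mathcal D_S:\widetilde M^S\to X$.
   Context: All topological spaces are Hausdorff, locally path connected and first countable. $(G,X)$ is an analytical structure: $X$ is a connected, locally connected, Hausdorff topological space and $G$ is a group acting faithfully on $X$ by homeomorphisms such that for all $\phi_1,\phi_2\in G$ and every nonempty open $U\subset X$, if $\phi_1$ and $\phi_2$ agree on $U$ they agree on $X$. A $(G,X)$-atlas is an atlas of charts valued in open subsets of $X$ whose changes of charts are locally restrictions of elements of $G$; a $(G,X)$-morphism is a map which in such charts is locally the restriction of an element of $G$. A subset $U$ of a space $M$ is portly if it is open, dense and locally connected in $M$ (i.e. $W\cap U$ is connected for every open connected $W\subset M$); a subset is skeletal if its complement is portly. An almost everywhere (a.e.) $(G,X)$-structure on $M$ is given by a $(G,X)$-atlas on some portly subset of $M$; any such structure has a maximal extension (extending both the portly domain and the atlas). A singular $(G,X)$-manifold is a locally connected Hausdorff second countable space $M$ endowed with a maximal a.e. $(G,X)$-structure; $\mathrm{Reg}(M)$ is the portly subset on which this maximal structure is defined, and $\mathrm{Sing}(M)=M\setminus\mathrm{Reg}(M)$.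 An a.e. $(G,X)$-morphism $f:M\to N$ is a continuous map for which there exist portly subsets $U\subset\mathrm{Reg}(M)$ and $V\subset\mathrm{Reg}(N)$ such that $f$ restricts to a $(G,X)$-morphism $U\to V$; an isomorphism is a homeomorphic a.e. $(G,X)$-morphism. An $X_A$-manifold is a singular $(G,X)$-manifold $M$ such that each singular point of $M$ admits an open neighborhood isomorphic to an open neighborhood of a singular point of some $X_\alpha$. A spread $p:X\to Y$ is a continuous map such that the connected components of preimages $p^{-1}(U)$ of open subsets $U\subset Y$ generate the topology of $X$. It is complete if for every $y\in\overline{p(X)}$ and every inclusion-increasing assignment $\chi$ associating to each open connected neighborhood $U$ of $y$ a connected component $\chi(U)$ of $p^{-1}(U)$, one has $\bigcap_U\chi(U)\neq\emptyset$. A completion of a spread $X\to Y$ is a complete spread $X'\to Y$ with an embedding $X\to X'$ over $Y$ whose image is portly in $X'$; every spread has a completion, unique up to isomorphism. A space $Z$ is semi-locally simply connected if every point $z$ has a neighborhood $U$ such that every loop in $U$ based at $z$ is null-homotopic in $Z$. The universal covering $\widetilde M^S\to M$ of $M$ possibly branched over $S$ is the completion of the spread $\widetilde{M\setminus S}\to M$, where $\widetilde{M\setminus S}$ is the universal covering of $M\setminus S$; $\widetilde M$ denotes $\widetilde M^{\mathrm{Sing}(M)}$ (similarly $\widetilde{X_\alpha}$). When $S\supset\mathrm{Sing}(M)$, $\widetilde M^S$ carries the unique a.e. $(G,X)$-structure for which the projection to $M$ is an a.e. $(G,X)$-morphism. A developing map of $\widetilde M^S\to M$ is any a.e. $(G,X)$-morphism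 $\widetilde M^S\to X$; a developing map of $X_\alpha$ is a developing map of $\widetilde{X_\alpha}\to X_\alpha$. *)

(* Defs.v *)
From HB Require Import structures.
From mathcomp Require Import all_boot all_order all_algebra.
From mathcomp Require Import all_classical all_reals.
From mathcomp Require Import topology normedtype.

Set Implicit Arguments.
Unset Strict Implicit.
Unset Printing Implicit Defensive.

Import Order.TTheory GRing.Theory Num.Theory.
Import numFieldNormedType.Exports.

Local Open Scope classical_set_scope.
Local Open Scope ring_scope.

Section Spaces.
Variable R : realType.

Definition unit_interval : set R := `[0, 1].

(* A path is a total function on [R]; only its values on [0, 1] matter. *)
Definition is_path (T : topologicalType) (x y : T) (gamma : R -> T) : Prop :=
  [/\ {within unit_interval, continuous gamma}, gamma 0 = x & gamma 1 = y].

Definition path_connected (T : topologicalType) (A : set T) : Prop :=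
  forall x y, A x -> A y ->
    exists2 gamma, is_path x y gamma & gamma @` unit_interval `<=` A.

(* Homotopy with fixed endpoints from the loop [gamma] to the constant loop. *)
Definition null_homotopic (T : topologicalType) (z : T) (gamma : R -> T) :
    Prop :=
  exists H : R * R -> T,
    [/\ {within unit_interval `*` unit_interval, continuous H},
        forall t, unit_interval t -> H (0, t) = gamma t,
        forall t, unit_interval t -> H (1, t) = z &
        forall s, unit_interval s -> H (s, 0) = z /\ H (s, 1) = z].

Definition simply_connected (T : topologicalType) : Prop :=
  path_connected [set: T] /\
  forall (z : T) gamma, is_path z z gamma -> null_homotopic z gamma.

Definition semi_locally_simply_connected (T : topologicalType) : Prop :=
  forall z : T, exists2 U, nbhs z U &
    forall gamma, is_path z z gamma -> gamma @` unit_interval `<=` U ->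
      null_homotopic z gamma.

Definition locally_path_connected (T : topologicalType) : Prop :=
  forall (x : T) A, nbhs x A ->
    exists U, [/\ open_nbhs x U, path_connected U & U `<=` A].

Definition locally_connected (T : topologicalType) : Prop :=
  forall (x : T) A, nbhs x A ->
    exists U, [/\ open_nbhs x U, connected U & U `<=` A].

Definition first_countable (T : topologicalType) : Prop :=
  forall x : T, exists2 B : set (set T),
    countable B & nbhs x = filter_from B id.

(* The standing assumption on all topological spaces. *)
Definition admissible (T : topologicalType) : Prop :=
  [/\ hausdorff_space T, locally_path_connected T & first_countable T].

Definition portly (M : topologicalType) (U : set M) : Prop :=
  [/\ open U, dense U &
      forall W : set M, open W -> connected W -> connected (W `&` U)].

Definition skeletal (M : topologicalType) (S : set M) : Prop := portly (~` S).

(* [f] restricts to a homeomorphism of the open set [V] onto the open set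
   [f @` V]; the values of [f] outside [V] are irrelevant. *)
Definition open_homeo_on (M N : topologicalType) (V : set M) (f : M -> N) :
    Prop :=
  [/\ open V, {within V, continuous f}, set_inj V f &
      forall W, open W -> W `<=` V -> open (f @` W)].

Definition homeomorphism (M N : topologicalType) (f : M -> N) : Prop :=
  continuous f /\
  exists g : N -> M, [/\ cancel f g, cancel g f & continuous g].

Definition embedding (M N : topologicalType) (f : M -> N) : Prop :=
  injective f /\
  forall U : set M, open U <-> exists2 V, open V & f @^-1` V = U.

Definition covering_map (E B : topologicalType) (pi : E -> B) : Prop :=
  [/\ continuous pi, range pi = [set: B] &
      forall b : B, exists2 U, open_nbhs b U &
        exists F : set (set E),
          [/\ \bigcup_(V in F) V = pi @^-1` U, trivIset F id &
              forall V, F V -> open_homeo_on V pi /\ pi @` V = U]].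

Definition universal_covering (E B : topologicalType) (pi : E -> B) : Prop :=
  covering_map pi /\ simply_connected E.

Definition is_component (T : topologicalType) (A C : set T) : Prop :=
  exists2 x, A x & C = connected_component A x.

Definition spread (T Y : topologicalType) (p : T -> Y) : Prop :=
  continuous p /\
  basis [set C | exists2 U, open U & is_component (p @^-1` U) C].

Definition complete_spread (T Y : topologicalType) (p : T -> Y) : Prop :=
  spread p /\
  forall y, closure (range p) y ->
  forall chi : set Y -> set T,
    (forall U, open_nbhs y U -> connected U ->
       is_component (p @^-1` U) (chi U)) ->
    (forall U V, open_nbhs y U -> connected U -> open_nbhs y V ->
       connected V -> U `<=` V -> chi U `<=` chi V) ->
    exists x, forall U, open_nbhs y U -> connected U -> chi U x.

(* [p : T -> Y], together with [j : E -> T], is a completion of [q : E -> Y]. *)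
Definition completion (E T Y : topologicalType)
    (q : E -> Y) (p : T -> Y) (j : E -> T) : Prop :=
  [/\ complete_spread p, embedding j, p \o j =1 q & portly (range j)].

(* [p : T -> M] is the universal covering of [M] possibly branched over [S];
   it is unique only up to isomorphism, hence a predicate. *)
Definition universal_branched_covering (M : topologicalType) (S : set M)
    (T : topologicalType) (p : T -> M) : Prop :=
  exists (E : topologicalType) (pi : E -> set_type (~` S)) (j : E -> T),
    universal_covering pi /\ completion (set_val \o pi) p j.

End Spaces.

Section GXStructures.
Variable R : realType.
Variables (X : topologicalType) (G : groupType) (act : G -> X -> X).

Record analytical_structure : Prop := AnalyticalStructure {
  an_admissible : admissible R X;
  an_connected : connected [set: X];
  an_locally_connected : locally_connected X;
  an_act1 : forall x, act 1%g x = x;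
  an_actM : forall g h x, act (g * h)%g x = act g (act h x);
  an_faithful : forall g h, act g =1 act h -> g = h;
  an_continuous : forall g, continuous (act g);
  an_analytic : forall g h (U : set X), open U -> U !=set0 ->
    (forall x, U x -> act g x = act h x) -> act g =1 act h }.

(* A chart is a domain together with a map, of which only the values on the
   domain matter; a maximal atlas contains all the extensions outside the
   domain of each of its charts. *)
Definition chart (M : Type) : Type := (set M * (M -> X))%type.

Definition is_chart (M : topologicalType) (c : chart M) : Prop :=
  open_homeo_on c.1 c.2.

Definition compatible (M : topologicalType) (c d : chart M) : Prop :=
  forall x, c.1 x -> d.1 x ->
    exists g, \forall y \near x, d.2 y = act g (c.2 y).

Definition atlas_domain (M : Type) (AM : set (chart M)) : set M :=
  \bigcup_(c in AM) c.1.

(* An a.e. (G,X)-structure: a (G,X)-atlas on the portly set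
   [atlas_domain AM]. *)
Definition ae_structure (M : topologicalType) (AM : set (chart M)) : Prop :=
  [/\ forall c, AM c -> is_chart c,
      forall c d, AM c -> AM d -> compatible c d &
      portly (atlas_domain AM)].

Definition maximal_ae_structure (M : topologicalType) (AM : set (chart M)) :
    Prop :=
  ae_structure AM /\
  forall AM', ae_structure AM' -> AM `<=` AM' -> AM' = AM.

Definition gx_morphism_on (M N : topologicalType) (AM : set (chart M))
    (AN : set (chart N)) (U : set M) (V : set N) (f : M -> N) : Prop :=
  (forall x, U x -> V (f x)) /\
  forall x c d, U x -> AM c -> c.1 x -> AN d -> d.1 (f x) ->
    exists g, \forall y \near x,
      [/\ c.1 y, d.1 (f y) & d.2 (f y) = act g (c.2 y)].

Definition ae_morphism (M N : topologicalType) (AM : set (chart M))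
    (AN : set (chart N)) (f : M -> N) : Prop :=
  continuous f /\
  exists U V, [/\ portly U, U `<=` atlas_domain AM,
                  portly V, V `<=` atlas_domain AN &
                  gx_morphism_on AM AN U V f].

Definition ae_isomorphism (M N : topologicalType) (AM : set (chart M))
    (AN : set (chart N)) (f : M -> N) : Prop :=
  homeomorphism f /\ ae_morphism AM AN f.

Definition restrict_atlas (M : topologicalType) (U : set M)
    (AM : set (chart M)) : set (chart U) :=
  [set (set_val @^-1` c.1, c.2 \o set_val) | c in AM].

Arguments restrict_atlas {M}.

Definition model_atlas : set (chart X) := [set ([set: X], idfun)].

Record singular_manifold := SingularManifold {
  sm_space :> topologicalType;
  sm_atlas : set (chart sm_space);
  sm_admissible : admissible R sm_space;
  sm_locally_connected : locally_connected sm_space;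
  sm_second_countable : @second_countable sm_space;
  sm_maximal : maximal_ae_structure sm_atlas }.

Arguments sm_atlas : clear implicits.

Definition Reg (M : singular_manifold) : set M := atlas_domain (sm_atlas M).

Arguments Reg : clear implicits.

Definition Sing (M : singular_manifold) : set M := ~` Reg M.

Definition model_space (M : singular_manifold) : Prop :=
  connected [set: M] /\ semi_locally_simply_connected R (set_type (Reg M)).

Arguments Sing : clear implicits.

(* [M] is an X_A-manifold. *)
Definition modelled_on (A : Type) (XA : A -> singular_manifold)
    (M : singular_manifold) : Prop :=
  forall x, Sing M x ->
    exists2 U : set M, open_nbhs x U &
    exists (a : A) (y : XA a) (V : set (XA a)) (h : U -> V),
      [/\ Sing (XA a) y, open_nbhs y V &
          ae_isomorphism (restrict_atlas U (sm_atlas M))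
                         (restrict_atlas V (sm_atlas (XA a))) h].

(* The universal covering of [M] possibly branched over [S], with the a.e.
   (G,X)-structure for which the projection is an a.e. (G,X)-morphism (unique
   when [S] is skeletal and contains [Sing M]). *)
Record branched_cover (M : singular_manifold) (S : set M) := BranchedCover {
  bc_space :> topologicalType;
  bc_proj : bc_space -> M;
  bc_atlas : set (chart bc_space);
  bc_admissible : admissible R bc_space;
  bc_universal : universal_branched_covering R S bc_proj;
  bc_maximal : maximal_ae_structure bc_atlas;
  bc_morphism : ae_morphism bc_atlas (sm_atlas M) bc_proj }.

Arguments bc_proj {M S}.
Arguments bc_atlas {M S}.

Definition developing_map (M : singular_manifold) (S : set M)
    (Mt : branched_cover S) (D : Mt -> X) : Prop :=
  ae_morphism (bc_atlas Mt) model_atlas D.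

Definition admits_developing_map (M : singular_manifold) (S : set M)
    (Mt : branched_cover S) : Prop :=
  exists D : Mt -> X, developing_map D.

End GXStructures.

Arguments restrict_atlas {X M}.
Arguments sm_atlas {R X G act}.
Arguments Reg {R X G act}.
Arguments Sing {R X G act}.
Arguments bc_proj {R X G act M S}.
Arguments bc_atlas {R X G act M S}.

(* Main.v *)
Require Import Defs.
From HB Require Import structures.
From mathcomp Require Import all_boot all_order all_algebra.
From mathcomp Require Import all_classical all_reals.
From mathcomp Require Import topology normedtype.
From mathcomp Require Import lra.

(** The unbranched part [E] of the branched cover [Mt] is the universal covering
    of the complement of [S], which lies in the regular part of [M]. The
    structure of [M] pulls back to [E], and since [E] is simply connected, the
    local charts can be continued consistently into a developing map [D] on [E]
    ([developing_map_simply_connected]). What has to be shown is that [D] extends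
    continuously to [Mt]; being an a.e. morphism then only concerns the portly
    subset [E]. As [E] is dense and [X] is Hausdorff, it is enough to extend [D]
    near each point [x] of [Mt] ([extension_glue]).

    If [x] lies above a regular point of [M], take a chart [c] around it. By
    analyticity, [D] is one and the same translate of [c] composed with the
    projection on the whole component above the domain of [c], and this formula
    defines the extension ([regular_extension]).

    If [x] lies above a singular point, an open set [U] around that point is
    identified with an open set of a model [N], whose branched cover [Nt] comes
    with a developing map [Dn] defined everywhere. Continuing [D] and [Dn] along
    corresponding paths gives [D = act g0 Dn] for a fixed [g0], but the component
    above [U] need not lift to the covering of the regular part of [N], because
    its loops may be essential there. What survives is a
    statement about sets of values. If a component [C] above a small open [W] and
    a component [Q] above its image in [N] contain one pair of corresponding
    points with corresponding germs, then every value of [D] on [C] is a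
    translate by [g0] of a value of [Dn] on [Q] ([matched_spread]): the points of
    [C] that have a partner in [Q] form an open and closed subset, by evenly
    covered neighborhoods in the model, and [C] stays connected after removing
    a skeletal set.

    Now let [W] shrink along a countable base and choose the components [Q]
    decreasing. Since the cover of the model is a complete spread, they have a
    common point [xi] and form a base of neighborhoods of it ([adapted_exists],
    [small_model_cell]), so that [D] tends to [act g0 (Dn xi)] at [x]. The same
    selection made at the neighbors of [x], within the same components, shows
    that the extension is continuous ([cells_match_extension]).

    The monodromy statement behind the first step is proved for transitions in
    [G] given pointwise ([flat_section]): a flat section exists over segments and
    over rectangles by gluing, hence is unchanged along null-homotopic loops. *)

Set Implicit Arguments.
Unset Strict Implicit.
Unset Printing Implicit Defensive.

Import Order.TTheory GRing.Theory Num.Theory.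
Import numFieldNormedType.Exports.

Local Open Scope classical_set_scope.

(** * Connected and portly sets *)

Lemma near_comp (T U : topologicalType) (u : T -> U) x (P : U -> Prop) :
  {for x, continuous u} -> (\forall y \near u x, P y) ->
  \forall y \near x, P (u y).
Proof. by move=> cu nP; exact: cu nP. Qed.

Lemma pair_continuous_at (T U V : topologicalType) (f : T -> U) (g : T -> V)
  x : {for x, continuous f} -> {for x, continuous g} ->
  {for x, continuous (fun y => (f y, g y))}.
Proof. by move=> cf cg; exact: (cvg_pair cf cg). Qed.

(** Connectedness as an induction principle: a property that spreads to nearby
    points of [A] holds on all of [A] as soon as it holds somewhere. In this
    form it passes through germs, sections and subspaces without mentioning
    relatively clopen sets. *)
Lemma connected_constP (T : topologicalType) (A : set T) :
  connected A <->
  forall P : T -> Prop,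
    (forall x, A x -> \forall y \near x, A y -> (P x <-> P y)) ->
    forall x y, A x -> A y -> P x -> P y.
Proof.
split=> [cA P locP x y Ax Ay Px|cstA B [x Bx] [C oC BAC] [D cD BAD]].
  suff AP : A `&` P = A by move: Ay; rewrite -[in X in X -> _]AP => -[].
  apply: cA; first by exists x.
    exists (interior [set z | A z -> P z]); first exact: open_interior.
    apply/seteqP; split=> z [Az Pz]; split=> //.
      by near=> w => Aw; apply/(near (locP z Az) w).
    exact: nbhs_singleton Pz Az.
  exists (~` interior [set z | A z -> ~ P z]).
    by rewrite closedC; exact: open_interior.
  apply/seteqP; split=> z [Az Pz]; split=> //.
    by move=> /nbhs_singleton /(_ Az).
  apply: contrapT => nPz; apply: Pz.
  by near=> w => Aw Pw; apply: nPz; apply/(near (locP z Az) w).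
have BA z : B z -> A z by rewrite BAC => -[].
apply/seteqP; split=> // y Ay.
apply: (cstA B _ x) => // [z Az|]; last exact: BA.
have [Bz|nBz] := pselect (B z).
  have Cz : C z by move: Bz; rewrite BAC => -[].
  near=> w => Aw; split=> // _; rewrite BAC; split=> //.
  by near: w; exact: open_nbhs_nbhs.
have nDz : ~ D z by move=> Dz; apply: nBz; rewrite BAD.
near=> w => Aw; split=> // Bw; exfalso.
have : (~` D) w.
  by near: w; apply: open_nbhs_nbhs; split=> //; exact: closed_openC.
by apply; move: Bw; rewrite BAD => -[].
Unshelve. all: by end_near. Qed.

Lemma image_connected (T U : topologicalType) (A : set T) (f : T -> U) :
  (forall x, A x -> {for x, continuous f}) -> connected A ->
  connected (f @` A).
Proof.
move=> cf cA; apply: connected_continuous_connected => //.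
by apply/subspace_continuousP => x Ax; apply: cvg_within_filter; exact: cf.
Qed.

Lemma path_connected_connected (R : realType) (T : topologicalType)
  (A : set T) : path_connected R A -> connected A.
Proof.
move=> pA; apply/connected_constP => P locP x y Ax Ay Px.
have [g [cg g0 g1] gA] := pA x y Ax Ay.
have cU : connected (@unit_interval R) by exact: segment_connected.
have u0 : @unit_interval R 0%R by rewrite /unit_interval /= in_itv/= lexx ler01.
have u1 : @unit_interval R 1%R by rewrite /unit_interval /= in_itv/= lexx ler01.
rewrite -g1.
apply: (connected_constP _).1 cU (P \o g) _ _ _ u0 u1 _; last first.
  by rewrite /= g0.
move=> t ut /=.
have := (subspace_continuousP _ _).1 cg t ut _ (locP _ (gA _ (imageP g ut))).
rewrite /nbhs/= /within /=; apply: filterS => s h us.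
by apply: h => //; apply: gA; exists s.
Qed.

Lemma lpc_locally_connected (R : realType) (T : topologicalType) :
  locally_path_connected R T -> locally_connected T.
Proof.
move=> lT x A /lT[U [oU pU UA]]; exists U; split=> //.
exact: path_connected_connected pU.
Qed.

Lemma open_connected_component (T : topologicalType) (A : set T) x :
  locally_connected T -> open A -> open (connected_component A x).
Proof.
move=> lT oA; rewrite openE => y Cy.
have Ay := connected_component_sub Cy.
have [U [[oU Uy] cU UA]] := lT y A (open_nbhs_nbhs (conj oA Ay)).
apply: (filterS _ (open_nbhs_nbhs (conj oU Uy))) => z Uz.
apply: (connected_component_trans Cy).
exact: connected_component_max Uy UA cU _ Uz.
Qed.

Lemma connected_component_mono (T : topologicalType) (A B : set T) x :
  A `<=` B -> connected_component A x `<=` connected_component B x.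
Proof.
move=> AB y [C [Cx CA cC] Cy]; exists C => //; split=> //.
exact: subset_trans AB.
Qed.

(** Portliness is a local property: a dense subset [B] of a connected open set
    that does not disconnect it locally does not disconnect it. Each point [x]
    only has to provide a connected part [L] of [B] that fills [B] near [x], so
    that a property locally constant on [B] has a well-defined value at [x]. *)
Lemma connected_dense_local (T : topologicalType) (K B : set T) :
  open K -> connected K -> K `<=` closure B ->
  (forall x, K x -> exists L, [/\ connected L, L `<=` K `&` B &
     \forall y \near x, B y -> L y]) ->
  connected (K `&` B).
Proof.
move=> oK cK KB loc; apply/connected_constP => P locP x y [Kx Bx] [Ky By] Px.
have cstL z L : connected L -> L `<=` K `&` B -> L z -> P z ->
    forall w, L w -> P w.
  move=> cL LKB Lz Pz w Lw.
  apply: ((connected_constP _).1 cL P _ z w) => // v Lv.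
  by apply: filterS (locP v (LKB _ Lv)) => u h /LKB.
pose P' (z : T) := \forall w \near z, B w -> P w.
have P'P z : K z -> B z -> P z -> P' z.
  move=> Kz Bz Pz; have [L [cL LKB nL]] := loc z Kz.
  apply: (filterS _ nL) => w h Bw; apply: (cstL z L) => //; last exact: h.
  exact: (nbhs_singleton nL).
suff /nbhs_singleton : P' y by apply.
have cP := (connected_constP _).1 cK P'; apply: cP Kx Ky (P'P _ Kx Bx Px).
move=> z Kz; have [L [cL LKB nL]] := loc z Kz.
have [[w [Lw Pw]]|LP] := pselect (exists w, L w /\ P w).
  have P'z : P' z by apply: (filterS _ nL) => v h Bv; exact: (cstL w L) (h Bv).
  by apply: filterS (nbhs_interior P'z).
have nP' v : K v -> (\forall u \near v, B u -> L u) -> ~ P' v.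
  move=> Kv nLv P'v; have [u [Bu [h1 h2]]] := KB _ Kv _ (filterI nLv P'v).
  by apply: LP; exists u; split; [exact: h1|exact: h2].
apply: filterS (nbhs_interior nL) => v nLv Kv; split=> P'v; exfalso.
  exact: (nP' z).
exact: (nP' v).
Qed.

Lemma portlyI (T : topologicalType) (U V : set T) :
  portly U -> portly V -> portly (U `&` V).
Proof.
move=> [oU dU cU] [oV dV cV]; split; first exact: openI.
  move=> O O0 oO; have /dV := dU O O0 oO.
  by move=> /(_ (openI oO oU)); rewrite -setIA.
by move=> W oW cW; rewrite setIA; apply: cV; [exact: openI|exact: cU].
Qed.

Lemma portly_setT (T : topologicalType) : portly [set: T].
Proof.
split; first exact: openT.
- by move=> O O0 _; rewrite setIT.
- by move=> W _ cW; rewrite setIT.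
Qed.

(** * Open maps and embeddings *)

Section OpenMaps.

(** A chart, a covering and an embedding with open image have it in common that
    they do not crush neighborhoods; for germs of maps into a rigid structure
    nothing else about them matters. *)
Definition open_at (T U : topologicalType) (f : T -> U) (x : T) : Prop :=
  forall B, nbhs x B -> nbhs (f x) (f @` B).

Lemma open_at_comp (T U V : topologicalType) (f : T -> U) (g : U -> V) x :
  open_at f x -> open_at g (f x) -> open_at (g \o f) x.
Proof. by move=> of_ og B /of_ /og; rewrite -image_comp. Qed.

Lemma open_at_near (T U : topologicalType) (f g : T -> U) x :
  (\forall y \near x, f y = g y) -> open_at g x -> open_at f x.
Proof.
move=> fg og B nB; rewrite (nbhs_singleton fg).
apply: (filterS _ (og _ (filterI fg nB))) => _ [y [fgy By] <-].
by exists y.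
Qed.

Lemma open_homeo_on_open_at (T U : topologicalType) (V : set T) (f : T -> U) x :
  open_homeo_on V f -> V x -> open_at f x.
Proof.
move=> [oV _ _ opV] Vx B nB.
have oW : open (V `&` interior B) by apply: openI => //; exact: open_interior.
have := opV _ oW (@subIsetl _ _ _) => oI.
have Ix : (f @` (V `&` interior B)) (f x) by exists x.
apply: filterS (open_nbhs_nbhs (conj oI Ix)) => _ [y [_ By] <-].
by exists y => //; exact: nbhs_singleton.
Qed.

Lemma open_homeo_on_continuous (T U : topologicalType) (V : set T)
  (f : T -> U) x : open_homeo_on V f -> V x -> {for x, continuous f}.
Proof.
move=> [oV cf _ _] Vx.
have := (subspace_continuousP _ _).1 cf x Vx.
by rewrite within_interior // (interior_id V).1.
Qed.

Variables (T U : topologicalType) (f : T -> U).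
Hypothesis ef : embedding f.

Lemma embedding_continuous : continuous f.
Proof. by apply/continuousP => B oB; apply/(ef.2 _); exists B. Qed.

Lemma embedding_nbhs x (A : set T) :
  nbhs x A -> exists2 B, open_nbhs (f x) B & f @^-1` B `<=` A.
Proof.
rewrite nbhsE => -[C [oC Cx] CA].
have [B oB BC] := (ef.2 C).1 oC.
by exists B; [split=> //; move: Cx; rewrite -BC|rewrite BC].
Qed.

Lemma embedding_preimage_connected (W : set U) :
  connected W -> W `<=` range f -> connected (f @^-1` W).
Proof.
move=> cW Wf; apply/connected_constP => P locP x y Wx Wy Px.
pose Q u := exists2 z, f z = u & P z.
have QP z : Q (f z) <-> P z.
  split=> [[w /ef.1 ->]//|Pz]; by exists z.
apply/QP; have cQ := (connected_constP _).1 cW Q.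
apply: cQ Wx Wy _; last exact/QP.
move=> u Wu; have [z _ fz] := Wf _ Wu; move: Wu; rewrite -fz => Wz.
have [B [oB Bz] BA] := embedding_nbhs (locP z Wz).
apply: filterS (open_nbhs_nbhs (conj oB Bz)) => v Bv Wv.
have [w _ fw] := Wf _ Wv; rewrite -fw in Bv Wv *.
by rewrite !QP; apply: BA.
Qed.

Hypothesis of_ : open (range f).

Lemma embedding_open_at x : open_at f x.
Proof.
move=> B /embedding_nbhs[C [oC Cx] CB].
have oI := openI oC of_.
have Ix : (C `&` range f) (f x) by split=> //; exists x.
apply: filterS (open_nbhs_nbhs (conj oI Ix)) => z [Cz [y _ fy]].
by exists y => //; apply: CB; rewrite /= fy.
Qed.

End OpenMaps.

Lemma portly_range_preimage (E T : topologicalType) (j : E -> T) (C : set T) :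
  embedding j -> portly (range j) -> open C -> connected C ->
  connected (j @^-1` C).
Proof.
move=> ej [_ _ cjr] oC cC; have -> : j @^-1` C = j @^-1` (C `&` range j).
  by apply/seteqP; split=> [e Ce|e []//]; split=> //; exists e.
by apply: embedding_preimage_connected => //; exact: cjr.
Qed.

(** * Rigidity of germs *)

Section Rigidity.
Variables (R : realType) (X : topologicalType) (G : groupType).
Variable act : G -> X -> X.
Hypothesis hGX : analytical_structure R act.

Let act1 := an_act1 hGX.
Let actM := an_actM hGX.

Lemma actK g : cancel (act g) (act g^-1%g).
Proof. by move=> x; rewrite -actM mulVg act1. Qed.

Lemma actVK g : cancel (act g^-1%g) (act g).
Proof. by move=> x; rewrite -actM mulgV act1. Qed.

Lemma act_open_at g x : open_at (act g) x.
Proof.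
move=> B nB; have := an_continuous hGX (g := g^-1%g) (x := act g x).
rewrite /continuous_at actK => /(_ _ nB) nB'.
apply: (@filterS _ (nbhs (act g x)) _ (act g^-1%g @^-1` B)) => // y By.
by exists (act g^-1%g y) => //; rewrite actVK.
Qed.

Lemma hausdorff_eq_closure (T U : topologicalType) (f g : T -> U)
  (B : set T) z : hausdorff_space U -> closure B z ->
  {for z, continuous f} -> {for z, continuous g} ->
  (forall y, B y -> f y = g y) -> f z = g z.
Proof.
move=> hU clB cf cg fg; apply: hU => A C nA nC.
have nAC : nbhs z (f @^-1` A `&` g @^-1` C).
  by apply: filterI; [exact: cf|exact: cg].
have [y [By [Ay Cy]]] := clB _ nAC.
by exists (f y); split=> //=; rewrite fg.
Qed.

(** The image of a neighborhood contains a nonempty open set, on which two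
    elements of [G] that agree are equal by analyticity. *)
Lemma germ_unique (T : topologicalType) (f : T -> X) z g h :
  open_at f z -> (\forall y \near z, act g (f y) = act h (f y)) -> g = h.
Proof.
move=> of_ /of_ /=; rewrite nbhsE => -[O [oO Oz] OB].
apply: (an_faithful hGX); apply: (an_analytic hGX oO); first by exists (f z).
by move=> x /OB [y yB <-].
Qed.

(** Where [f2 = act g f1] near a point, [g] is determined by the germs, so it is
    locally constant on [N `&` W] and hence constant; the equality then extends
    to the closure because [X] is Hausdorff. The set [W] is typically portly:
    this is how a relation known almost everywhere becomes a relation
    everywhere. *)
Lemma rigidity (T : topologicalType) (f1 f2 : T -> X) (N W : set T) :
  connected (N `&` W) -> (forall z, N z -> closure (N `&` W) z) ->
  (forall z, N z -> {for z, continuous f1}) ->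
  (forall z, N z -> {for z, continuous f2}) ->
  (forall z, (N `&` W) z -> open_at f1 z) ->
  (forall z, (N `&` W) z ->
     exists g, \forall y \near z, f2 y = act g (f1 y)) ->
  exists g, forall z, N z -> f2 z = act g (f1 z).
Proof.
move=> cNW dW cf1 cf2 of1 loc.
have [[z0 NWz0]|NW0] := pselect (N `&` W !=set0); last first.
  exists 1%g => z /dW /(_ setT filterT) [y [NWy _]].
  by case: NW0; exists y.
have [g gz0] := loc _ NWz0; exists g.
have eqW z : (N `&` W) z -> f2 z = act g (f1 z).
  move=> NWz; apply: (@nbhs_singleton _ z (fun z => f2 z = act g (f1 z))).
  have cP := (connected_constP _).1 cNW.
  apply: (cP (fun z => \forall y \near z, f2 y = act g (f1 y))) NWz0 NWz gz0.
  move=> {}z NWz; have [h hz] := loc _ NWz.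
  near=> y => NWy.
  have hy : \forall w \near y, f2 w = act h (f1 w).
    by near: y; apply: nbhs_interior hz.
  split=> gh.
    suff -> : g = h by [].
    apply: (germ_unique (of1 _ NWz)).
    by apply: (filterS2 _ _ gh hz) => w <-.
  suff -> : g = h by [].
  apply: (germ_unique (of1 _ NWy)).
  by apply: (filterS2 _ _ gh hy) => w <-.
move=> z Nz; have [hX _ _] := an_admissible hGX.
apply: (@hausdorff_eq_closure _ _ f2 (act g \o f1) (N `&` W)).
- exact: hX.
- exact: dW.
- exact: cf2.
- by apply: continuous_comp; [exact: cf1|exact: (an_continuous hGX)].
- exact: eqW.
Unshelve. all: by end_near. Qed.

End Rigidity.

(** * Locally constant transitions and their flat sections *)

Section LocalSystems.
Variable G : groupType.
Local Open Scope group_scope.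

(** The transitions of a principal [G]-covering of [Z] trivialized near each
    point [z] by a section of its own: [t z z'] compares the trivializations
    chosen at [z] and at [z'], and is meaningful only for [z'] near [z]. For
    developing maps, the covering is that of the germs of local developing
    maps, trivialized by the choice of a chart at each point. Only
    neighborhoods of points occur, so no covering space has to be built. *)
Definition cocycle (Z : topologicalType) (t : Z -> Z -> G) : Prop :=
  forall z, \forall z' \near z, \forall z'' \near z',
    t z z'' = t z z' * t z' z''.

(** A section over [K] of the covering with transitions [t], read in the chosen
    trivializations. *)
Definition flat (Z : topologicalType) (t : Z -> Z -> G) (K : set Z)
    (s : Z -> G) : Prop :=
  forall z, K z -> \forall z' \near z, K z' -> s z' = s z * t z z'.

Lemma cocycle_refl (Z : topologicalType) (t : Z -> Z -> G) z :
  cocycle t -> t z z = 1.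
Proof.
move=> /(_ z) /nbhs_singleton /nbhs_singleton h.
by apply: (mulgI (t z z)); rewrite -h mulg1.
Qed.

Lemma cocycle_comp (Y Z : topologicalType) (u : Y -> Z) (t : Z -> Z -> G) :
  continuous u -> cocycle t -> cocycle (fun a b => t (u a) (u b)).
Proof.
move=> cu ct y; apply: filterS (near_comp (cu y) (ct (u y))) => y' h.
exact: near_comp (cu y') h.
Qed.

Lemma flat_comp (Y Z : topologicalType) (u : Y -> Z) (t : Z -> Z -> G) K L s :
  continuous u -> (forall y, L y -> K (u y)) -> flat t K s ->
  flat (fun a b => t (u a) (u b)) L (s \o u).
Proof.
move=> cu LK fs y Ly.
by apply: filterS (near_comp (cu y) (fs _ (LK _ Ly))) => y' /= h /LK.
Qed.

Section Flat.
Variable Z : topologicalType.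
Implicit Types (t : Z -> Z -> G) (K L : set Z) (s : Z -> G).

Lemma flat_mul t K s g : flat t K s -> flat t K (fun z => g * s z).
Proof.
by move=> fs z Kz; apply: filterS (fs z Kz) => z' h Kz'; rewrite h // mulgA.
Qed.

Lemma flat_sub t K L s : L `<=` K -> flat t K s -> flat t L s.
Proof.
move=> LK fs z Lz; apply: filterS (fs z (LK _ Lz)) => z' h Lz'.
by apply: h; exact: LK.
Qed.

Lemma eq_flat t t' K s s' :
  (forall z z', K z -> K z' -> t z z' = t' z z') ->
  (forall z, K z -> s z = s' z) -> flat t K s -> flat t' K s'.
Proof.
move=> tt' ss' fs z Kz; apply: filterS (fs z Kz) => z' h Kz'.
by rewrite -!ss' // -tt' // h.
Qed.

Lemma flat_cst t K g : (forall z z', K z -> K z' -> t z z' = 1) ->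
  flat t K (fun=> g).
Proof.
by move=> t1 z Kz; apply: nearW => z' Kz'; rewrite t1 // mulg1.
Qed.

Lemma flat_uniq t K s s' z0 z : connected K -> flat t K s -> flat t K s' ->
  K z0 -> K z -> s z0 = s' z0 -> s z = s' z.
Proof.
move=> cK fs fs' Kz0 Kz ss'; have cP := (connected_constP _).1 cK.
apply: (cP (fun z => s z = s' z)) Kz0 Kz ss' => {}z Kz.
apply: (filterS2 _ _ (fs z Kz) (fs' z Kz)) => z' h h' Kz'.
by rewrite h // h' //; split=> [->//|/mulIg].
Qed.

(** Closedness is what makes this true: a point outside [K] has a neighborhood
    that misses [K], so that only the points of [L] constrain it. *)
Lemma flatU t K L s : closed K -> closed L -> flat t K s -> flat t L s ->
  flat t (K `|` L) s.
Proof.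
move=> clK clL fK fL z _.
have near1 (A : set Z) : closed A -> flat t A s ->
    \forall z' \near z, A z' -> s z' = s z * t z z'.
  move=> clA fA; have [/fA//|nAz] := pselect (A z).
  have nA : nbhs z (~` A).
    by apply: open_nbhs_nbhs; split=> //; exact: closed_openC.
  by apply: filterS nA.
apply: (filterS2 _ _ (near1 K clK fK) (near1 L clL fL)) => z' hK hL.
by case.
Qed.

(** The two sections differ by a constant of [G] on the connected intersection;
    correcting [s'] by this constant makes them agree there. *)
Lemma flat_glue t K L s s' z0 : closed K -> closed L ->
  connected (K `&` L) -> (K `&` L) z0 -> flat t K s -> flat t L s' ->
  exists s'', flat t (K `|` L) s''.
Proof.
move=> clK clL cKL [Kz0 Lz0] fs fs'.
pose s1 z := s z0 * (s' z0)^-1 * s' z.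
have fs1 : flat t L s1 by exact: flat_mul.
pose r z := if pselect (K z) then s z else s1 z.
exists r; apply: flatU => //.
  by apply: eq_flat fs => // z Kz; rewrite /r; case: pselect.
apply: eq_flat fs1 => // z Lz; rewrite /r; case: pselect => // Kz.
have fsKL := flat_sub (@subIsetl _ K L) fs.
have fs1KL := flat_sub (@subIsetr _ K L) (flat_mul (s z0 * (s' z0)^-1) fs').
apply/esym/(flat_uniq cKL fsKL fs1KL (conj Kz0 Lz0) (conj Kz Lz)).
by rewrite mulgVK.
Qed.

(** By the cocycle relation, the trivialization at [z] is itself a section near
    [z]. *)
Lemma flat_local t z : cocycle t ->
  exists2 N, open_nbhs z N & flat t N (t z).
Proof.
move=> /(_ z); rewrite /prop_near1 nbhsE => -[N oN NP].
by exists N => // z' /NP; apply: filterS.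
Qed.

End Flat.
End LocalSystems.

(** * Flat sections over segments and rectangles *)

Section Cousin.
Variable R : realType.
Local Open Scope ring_scope.

(** Compactness of segments as an induction principle: what holds on short
    segments around each point and passes to juxtapositions holds on all
    segments. *)
Lemma cousin (P : R -> R -> Prop) :
  (forall a b c, a <= b -> b <= c -> P a b -> P b c -> P a c) ->
  (forall x, exists2 e, 0 < e &
    forall a b, x - e < a -> a <= b -> b < x + e -> P a b) ->
  forall a b, a <= b -> P a b.
Proof.
move=> addP locP a b ab.
pose Q x := forall y, a <= y -> y <= x -> P a y.
suff : Q b by apply.
have cI : connected `[a, b] by exact: segment_connected.
have Ia : `[a, b]%classic a by rewrite /= in_itv/= lexx.
have Ib : `[a, b]%classic b by rewrite /= in_itv/= lexx ab.
apply: ((connected_constP _).1 cI Q) Ia Ib _ => [x Ix|]; last first.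
  move=> y ay ya; have -> : y = a by apply/le_anti; rewrite ay ya.
  by have [e e0 +] := locP a; apply; lra.
have [e e0 he] := locP x.
have mono y z : x - e < y -> y < x + e -> x - e < z -> z < x + e ->
    a <= y -> Q y -> Q z.
  move=> y1 y2 z1 z2 ay Qy w aw wz.
  have [wy|yw] := leP w y; first exact: Qy.
  apply: (addP a y w) => //; [exact: ltW|exact: Qy|].
  by apply: he => //; lra.
have : \forall y \near x, `|x - y| < e by exact: nbhsx_ballx.
move=> nb; near=> y => Iy.
have : `|x - y| < e by near: y.
move: Ix Iy; rewrite /= !in_itv/= ltr_distl.
move=> /andP[ax _] /andP[ay _] /andP[h1 h2].
by split; apply: mono => //; lra.
Unshelve. all: by end_near. Qed.

End Cousin.

Section Square.
Variables (R : realType) (G : groupType).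
Local Open Scope ring_scope.

Lemma flat_segment (t : R -> R -> G) a b : cocycle t -> a <= b ->
  exists s, flat t `[a, b] s.
Proof.
move=> ct; apply: (@cousin _ (fun a b => exists s, flat t `[a, b] s)).
  move=> {}a {}b c ab bc [s fs] [s' fs'].
  have -> : `[a, c]%classic = `[a, b]%classic `|` `[b, c]%classic.
    apply/seteqP; split=> x /=; rewrite !in_itv/=.
      by move=> /andP[ax xc]; have [xb|bx] := leP x b; [left|right]; lra.
    by case; lra.
  have Iab : `[a, b]%classic `&` `[b, c]%classic = [set b].
    apply/seteqP; split=> x /=; rewrite !in_itv/=; last by move=> ->; lra.
    by move=> [h1 h2]; apply/eqP; lra.
  apply: (@flat_glue _ _ t _ _ s s' b); rewrite ?Iab //.
  - exact: itv_closed.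
  - exact: itv_closed.
  - exact: connected1.
move=> x.
have [N /open_nbhs_nbhs/nbhs_ballP[e /= e0 eN] fN] := flat_local x ct.
exists e => // c d xc cd dx; exists (t x).
apply: flat_sub fN => y; rewrite /= in_itv/= => ?; apply: eN.
by rewrite /ball/= ltr_distl; lra.
Qed.

Definition rect (a b c d : R) : set (R * R) := `[a, b] `*` `[c, d].

(** Cousin's induction is used twice: in the second coordinate it gives a section
    over a strip of positive width around each vertical segment, and in the
    first coordinate it glues such strips along vertical segments. *)
Lemma flat_rect (t : R * R -> R * R -> G) a b c d : cocycle t ->
  a <= b -> c <= d -> exists s, flat t (rect a b c d) s.
Proof.
move=> ct.
have rect_closed a' b' c' d' : closed (rect a' b' c' d').
  apply: (@closedI _ (fst @^-1` `[a', b']) (snd @^-1` `[c', d'])).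
    by apply: closed_comp; [move=> ? _; exact: cvg_fst|exact: itv_closed].
  by apply: closed_comp; [move=> ? _; exact: cvg_snd|exact: itv_closed].
(* the width of the strip is part of the induction: it shrinks when two
   pieces of the vertical segment are put together *)
have strip c' d' : c' <= d' -> forall x, exists2 e, 0 < e &
  exists s, flat t (rect (x - e) (x + e) c' d') s.
  move=> cd x; move: c' d' cd.
  apply: (@cousin _ (fun c d => exists2 e, 0 < e &
    exists s, flat t (rect (x - e) (x + e) c d) s)).
    move=> c1 c2 c3 c12 c23 [e e0 [s fs]] [e' e'0 [s' fs']].
    exists (Num.min e e'); first by rewrite lt_min e0 e'0.
    set m := Num.min e e'.
    have m0 : 0 < m by rewrite lt_min e0 e'0.
    have me : m <= e by rewrite ge_min lexx.
    have me' : m <= e' by rewrite ge_min lexx orbT.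
    have -> : rect (x - m) (x + m) c1 c3 =
        rect (x - m) (x + m) c1 c2 `|` rect (x - m) (x + m) c2 c3.
      apply/seteqP; split=> -[u v]; rewrite /rect /= !in_itv/=.
        by move=> [? ?]; have [?|?] := leP v c2; [left|right]; lra.
      by case; lra.
    have I12 : rect (x - m) (x + m) c1 c2 `&` rect (x - m) (x + m) c2 c3 =
        (fun u => (u, c2)) @` `[x - m, x + m].
      apply/seteqP; split=> -[u v]; rewrite /rect /= !in_itv/=.
        move=> [[? ?] [_ ?]]; exists u; first by rewrite in_itv/=; lra.
        by congr pair; apply/eqP; lra.
      by move=> [w + [<- <-]]; rewrite in_itv/=; lra.
    apply: (@flat_glue _ _ t _ _ s s' (x, c2)) => //; rewrite ?I12 //.
    - apply: image_connected; last exact: segment_connected.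
      by move=> u _; apply: pair_continuous_at; [exact: cvg_id|exact: cvg_cst].
    - by exists x => //; rewrite /= in_itv/=; lra.
    - apply: flat_sub fs => -[u v]; rewrite /rect /= !in_itv/=; lra.
    - apply: flat_sub fs' => -[u v]; rewrite /rect /= !in_itv/=; lra.
  move=> y; have [N oN fN] := flat_local (x, y) ct.
  move: oN => /open_nbhs_nbhs/nbhs_ballP[e /= e0 eN].
  exists e => // c1 c2 xc cd dx; exists (e / 2); first lra.
  exists (t (x, y)).
  apply: flat_sub fN => -[u v]; rewrite /rect /= !in_itv/= => ?; apply: eN.
  by split; rewrite /ball/= ltr_distl; lra.
move=> ab cd; move: a b ab.
apply: (@cousin _ (fun a b => exists s, flat t (rect a b c d) s)).
  move=> {}a {}b a' ab bc [s fs] [s' fs'].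
  have -> : rect a a' c d = rect a b c d `|` rect b a' c d.
    apply/seteqP; split=> -[u v]; rewrite /rect /= !in_itv/=.
      by move=> [? ?]; have [?|?] := leP u b; [left|right]; lra.
    by case; lra.
  have Iab : rect a b c d `&` rect b a' c d = (fun v => (b, v)) @` `[c, d].
    apply/seteqP; split=> -[u v]; rewrite /rect /= !in_itv/=.
      move=> [[? ?] [? ?]]; exists v; first by rewrite in_itv/=; lra.
      by congr pair; apply/eqP; lra.
    by move=> [w + [<- <-]]; rewrite in_itv/=; lra.
  apply: (@flat_glue _ _ t _ _ s s' (b, c)) => //; rewrite ?Iab //.
    apply: image_connected; last exact: segment_connected.
    by move=> u _; apply: pair_continuous_at; [exact: cvg_cst|exact: cvg_id].
  by exists c => //; rewrite /= in_itv/=; lra.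
move=> x; have [e e0 [s fs]] := strip c d cd x.
exists e => // a1 a2 xa aa ax; exists s.
by apply: flat_sub fs => -[u v]; rewrite /rect /= !in_itv/=; lra.
Qed.

End Square.

(** * Continuation along paths in a simply connected space *)

Section Paths.
Variable R : realType.
Local Open Scope ring_scope.

(** The retraction of the line onto [0, 1]: precomposing with it turns a path
    that is continuous within [0, 1] into a continuous map on the line. *)
Definition clamp (x : R) : R := (1 + `|x| - `|x - 1|) / 2.

Lemma clamp_continuous : continuous clamp.
Proof.
move=> x; apply: cvgM; last exact: cvg_cst.
apply: cvgB; last first.
  by apply: cvg_norm; apply: cvgB; [exact: cvg_id|exact: cvg_cst].
by apply: cvgD; [exact: cvg_cst|apply: cvg_norm; exact: cvg_id].
Qed.

Lemma clamp_unit x : unit_interval (clamp x).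
Proof.
rewrite /unit_interval /clamp /= in_itv/=.
have [x0|x0] := ger0P x; have [x1|x1] := ger0P (x - 1); apply/andP; split; lra.
Qed.

Lemma clamp_id x : unit_interval x -> clamp x = x.
Proof.
rewrite /unit_interval /clamp /= in_itv/= => ?.
by have [x0|x0] := ger0P x; have [x1|x1] := ger0P (x - 1); lra.
Qed.

Lemma continuous_retract (T U V : topologicalType) (A : set U) (f : U -> V)
  (r : T -> U) : {within A, continuous f} -> continuous r ->
  (forall x, A (r x)) -> continuous (f \o r).
Proof.
move=> /subspace_continuousP cf cr Ar x B nB.
have := cf _ (Ar x) B nB; rewrite /nbhs/= /within/= => nA.
by apply: filterS (near_comp (cr x) nA) => y; apply.
Qed.

Lemma continuous_closedU (T U : topologicalType) (K L : set T)
  (f g h : T -> U) : closed K -> closed L -> (forall x, K x \/ L x) ->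
  continuous f -> continuous g ->
  (forall x, K x -> h x = f x) -> (forall x, L x -> h x = g x) ->
  continuous h.
Proof.
move=> clK clL KL cf cg hf hg x B nB.
have near1 (A : set T) k : closed A -> continuous k ->
    (forall x, A x -> h x = k x) -> \forall y \near x, A y -> B (h y).
  move=> clA ck hk; have [Ax|nAx] := pselect (A x).
    have nk : nbhs x (k @^-1` B) by apply: ck; rewrite -hk.
    by apply: filterS nk => y By Ay; rewrite hk.
  have nA : nbhs x (~` A).
    by apply: open_nbhs_nbhs; split=> //; exact: closed_openC.
  by apply: filterS nA.
apply: (filterS2 _ _ (near1 K f clK cf hf) (near1 L g clL cg hg)) => y.
by case: (KL y) => [Ky /(_ Ky)|Ly _ /(_ Ly)].
Qed.

Let unit0 : @unit_interval R 0.
Proof. by rewrite /unit_interval /= in_itv/= lexx ler01. Qed.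

Let unit1 : @unit_interval R 1.
Proof. by rewrite /unit_interval /= in_itv/= lexx ler01. Qed.

Lemma path_connected_embedding (T U : topologicalType) (f : T -> U)
  (V : set U) : embedding f -> V `<=` range f -> path_connected R V ->
  path_connected R (f @^-1` V).
Proof.
move=> ef Vf pV x y Vx Vy.
have [g [/subspace_continuousP cg g0 g1] gV] := pV _ _ Vx Vy.
pose h t := xget x [set z | f z = g t].
have hg t : unit_interval t -> f (h t) = g t.
  move=> ut; have [z _ fz] := Vf _ (gV _ (imageP g ut)).
  exact: (@xgetPex _ x [set z | f z = g t] (ex_intro _ z fz)).
exists h; last by move=> _ [t ut <-]; rewrite /= hg //; apply: gV; exists t.
split; last 2 first.
- by apply: ef.1; rewrite hg.
- by apply: ef.1; rewrite hg.
apply/subspace_continuousP => t ut A /(embedding_nbhs ef)[B [oB Bh] BA].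
have gB : nbhs (g t) B by apply: open_nbhs_nbhs; rewrite -hg.
have := cg t ut B gB; rewrite /nbhs/= /within/=.
by apply: filterS => w hw uw; apply: BA; rewrite /= hg //; exact: hw.
Qed.

Lemma lpc_embedding (T U : topologicalType) (f : T -> U) :
  embedding f -> open (range f) -> locally_path_connected R U ->
  locally_path_connected R T.
Proof.
move=> ef orf lU x A nA.
have [V [[oV Vx] pV VA]] := lU _ _ (embedding_open_at ef orf nA).
exists (f @^-1` V); split.
- by split=> //; apply/(ef.2 _); exists V.
- by apply: path_connected_embedding pV => // z /VA[w _ <-]; exists w.
- by move=> w /= /VA[w' Aw' /ef.1 <-].
Qed.

Section Continuation.
Variables (G : groupType) (E : topologicalType) (t : E -> E -> G).
Hypothesis ct : cocycle t.

Definition along (c : R -> E) (a b : R) : G := t (c a) (c b).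

Lemma flat_constant_path (c : R -> E) (s : R -> G) z :
  (forall x, unit_interval x -> c x = z) ->
  flat (along c) `[0, 1] s -> s 0 = s 1.
Proof.
move=> cz fs; have f1 : flat (along c) `[0, 1] (fun=> s 0).
  by apply: flat_cst => a b ua ub; rewrite /along !cz // cocycle_refl.
exact: (flat_uniq (@segment_connected R 0 1) f1 fs unit0 unit1 erefl).
Qed.

(** Pull the transitions back to the unit square along a null-homotopy and take a
    flat section there: it is constant on the three sides that the homotopy
    maps to the base point, so it has equal values at the two ends of the side
    that carries the loop. *)
Lemma flat_loop (c : R -> E) (s : R -> G) z :
  simply_connected R E -> continuous c -> c 0 = z -> c 1 = z ->
  flat (along c) `[0, 1] s -> s 0 = s 1.
Proof.
move=> [_ scE] cc c0 c1 fs.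
have [|H [cH H0 H1 Hs]] := scE z c.
  by split=> //; exact: continuous_subspaceT.
pose r (z : R * R) := (clamp z.1, clamp z.2).
have cr : continuous r.
  move=> w; apply: (@pair_continuous_at _ _ _ (clamp \o fst) (clamp \o snd)).
    by apply: continuous_comp; [exact: cvg_fst|exact: clamp_continuous].
  by apply: continuous_comp; [exact: cvg_snd|exact: clamp_continuous].
have cHr : continuous (H \o r).
  by apply: continuous_retract cH cr _ => w; split; exact: clamp_unit.
have [tau ftau] : exists s, flat (fun a b => t ((H \o r) a) ((H \o r) b))
    (rect 0 1 0 1) s.
  by apply: flat_rect => //; exact: cocycle_comp.
have edge (u : R -> R * R) (d : R -> E) : continuous u ->
    (forall x, unit_interval x -> rect 0 1 0 1 (u x)) ->
    (forall x, unit_interval x -> H (u x) = d x) ->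
    flat (along d) `[0, 1] (tau \o u).
  move=> cu ur Hd; apply: eq_flat (flat_comp cu ur ftau) => // a b ua ub.
  have ru x : unit_interval x -> r (u x) = u x.
    by move=> /ur[u1 u2]; rewrite /r !clamp_id // -surjective_pairing.
  by rewrite /along /= !ru // !Hd.
have cid (x : R) : {for x, continuous (fun y : R => y)} by exact: cvg_id.
have ccst (k x : R) : {for x, continuous (fun _ : R => k : R)}.
  exact: cvg_cst.
have f0 : flat (along c) `[0, 1] (tau \o (fun x => (0, x))).
  apply: edge => x; first exact: (pair_continuous_at (ccst 0 x) (cid x)).
      by move=> ux; split.
  by move=> ?; exact: H0.
have e1 : tau (1, 0) = tau (1, 1).
  have f1 : flat (along (fun=> z)) `[0, 1] (tau \o (fun x => (1, x))).
    apply: edge => x; first exact: (pair_continuous_at (ccst 1 x) (cid x)).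
      by move=> ux; split.
    by move=> ?; exact: H1.
  exact: flat_constant_path f1.
have e2 : tau (0, 0) = tau (1, 0).
  have f1 : flat (along (fun=> z)) `[0, 1] (tau \o (fun x => (x, 0))).
    apply: edge => x; first exact: (pair_continuous_at (cid x) (ccst 0 x)).
      by move=> ux; split.
    by move=> ?; exact: (Hs x _).1.
  exact: flat_constant_path f1.
have e3 : tau (0, 1) = tau (1, 1).
  have f1 : flat (along (fun=> z)) `[0, 1] (tau \o (fun x => (x, 1))).
    apply: edge => x; first exact: (pair_continuous_at (cid x) (ccst 1 x)).
      by move=> ux; split.
    by move=> ?; exact: (Hs x _).2.
  exact: flat_constant_path f1.
pose k := (s 0 * (tau (0, 0))^-1)%g.
have k0 : s 0 = (k * tau (0, 0%R))%g by rewrite mulgVK.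
have cI := @segment_connected R 0 1.
rewrite k0 (flat_uniq cI fs (flat_mul k f0) unit0 unit1 k0).
by rewrite /= e2 e1 e3.
Qed.

(** Analytic continuation: along some path from [x] to [y], the section with
    value [1] over [x] arrives at [g] over [y]. The set of triples is a groupoid,
    and simple connectedness says that its isotropy groups are trivial. *)
Definition continued (x y : E) (g : G) : Prop :=
  exists (c : R -> E) (s : R -> G), [/\ continuous c, flat (along c) `[0, 1] s,
    c 0 = x /\ c 1 = y, s 0 = 1%g & s 1 = g].

Lemma continued_sym x y g : continued x y g -> continued y x g^-1%g.
Proof.
move=> [c [s [cc fs [c0 c1] s0 s1]]].
have cu : continuous (fun a : R => 1 - a).
  by move=> a; apply: cvgB; [exact: cvg_cst|exact: cvg_id].
have ur (a : R) : `[0, 1]%classic a -> `[0, 1]%classic (1 - a).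
  by rewrite /= !in_itv/= => ?; lra.
exists (c \o (fun a => 1 - a)), (fun a => g^-1 * s (1 - a))%g; split.
- by move=> a; apply: continuous_comp; [exact: cu|exact: cc].
- exact: flat_mul (flat_comp cu ur fs).
- by rewrite /= subr0 subrr.
- by rewrite subr0 s1 mulVg.
- by rewrite subrr s0 mulg1.
Qed.

Lemma continued_trans x y z g h :
  continued x y g -> continued y z h -> continued x z (g * h)%g.
Proof.
move=> [c [s [cc fs [c0 c1] s0 s1]]] [d [r [cd fr [d0 d1] r0 r1]]].
have cu : continuous (fun a : R => 2 * a).
  by move=> a; apply: cvgM; [exact: cvg_cst|exact: cvg_id].
have cv : continuous (fun a : R => 2 * a - 1).
  by move=> a; apply: cvgB; [exact: cu|exact: cvg_cst].
pose half (T : Type) (f g : R -> T) a := if a <= 1 / 2 then f a else g a.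
have halfl (T : Type) (f k : R -> T) a : a <= 1 / 2 -> half T f k a = f a.
  by rewrite /half => ->.
have halfr (T : Type) (f k : R -> T) a : f (1 / 2) = k (1 / 2) ->
    1 / 2 <= a -> half T f k a = k a.
  move=> fk ha; rewrite /half; case: ifPn => // ah.
  by have -> : a = 1 / 2 by apply/le_anti; rewrite ha ah.
have h2 : 2 * (1 / 2) = 1 :> R by lra.
have cd2 : c (2 * (1 / 2)) = d (2 * (1 / 2) - 1) by rewrite h2 subrr c1 d0.
have sr2 : s (2 * (1 / 2)) = (g * r (2 * (1 / 2) - 1)%R)%g.
  by rewrite h2 subrr s1 r0 mulg1.
exists (half _ (fun a => c (2 * a)) (fun a => d (2 * a - 1))).
exists (half _ (fun a => s (2 * a)) (fun a => g * r (2 * a - 1)%R)%g).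
split.
- apply: (@continuous_closedU R E [set a | a <= 1 / 2] [set a | 1 / 2 <= a]
    (fun a => c (2 * a)) (fun a => d (2 * a - 1))).
  + exact: closed_le.
  + exact: closed_ge.
  + by move=> a /=; have [|/ltW] := leP a (1 / 2); [left|right].
  + by move=> a; apply: continuous_comp; [exact: cu|exact: cc].
  + by move=> a; apply: continuous_comp; [exact: cv|exact: cd].
  + by move=> a; exact: halfl.
  + by move=> a; exact: halfr.
- have -> : `[0, 1]%classic =
      `[0, 1 / 2]%classic `|` `[1 / 2, 1]%classic :> set R.
    apply/seteqP; split=> a /=; rewrite !in_itv/=.
      by move=> ?; have [?|?] := leP a (1 / 2); [left|right]; lra.
    by case; lra.
  apply: flatU.
  + exact: itv_closed.
  + exact: itv_closed.
  + have ur (a : R) : `[0, 1 / 2]%classic a -> `[0, 1]%classic (2 * a).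
      by rewrite /= !in_itv/= => ?; lra.
    apply: eq_flat (flat_comp cu ur fs) => [a b|a].
      by rewrite /= !in_itv/= => ? ?; rewrite /along !halfl //; lra.
    by rewrite /= !in_itv/= => ?; rewrite halfl //; lra.
  + have ur (a : R) : `[1 / 2, 1]%classic a -> `[0, 1]%classic (2 * a - 1).
      by rewrite /= !in_itv/= => ?; lra.
    apply: eq_flat (flat_mul g (flat_comp cv ur fr)) => [a b|a].
      by rewrite /= !in_itv/= => /andP[? _] /andP[? _]; rewrite /along !halfr.
    by rewrite /= !in_itv/= => /andP[? _]; rewrite halfr.
- split; first by rewrite halfl ?mulr0 //; lra.
  rewrite halfr // ?mulr1; last by lra.
  by rewrite -d1; congr d; lra.
- by rewrite halfl ?mulr0 //; lra.
- rewrite halfr // ?mulr1; last by lra.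
  by rewrite -r1; congr (_ * r _)%g; lra.
Qed.

Lemma continued_exists x y : simply_connected R E -> exists g, continued x y g.
Proof.
move=> [pE _]; have [c [cc c0 c1] _] := pE x y I I.
have cc' : continuous (c \o clamp).
  exact: continuous_retract cc clamp_continuous clamp_unit.
have [s fs] := flat_segment (cocycle_comp cc' ct) ler01.
exists ((s 0%R)^-1 * s 1%R)%g, (c \o clamp).
exists (fun a => (s 0%R)^-1 * s a)%g; split=> //.
- exact: flat_mul.
- by rewrite /= !clamp_id.
- by rewrite mulVg.
Qed.

Lemma continued_uniq x y g h : simply_connected R E ->
  continued x y g -> continued x y h -> g = h.
Proof.
move=> scE xyg /continued_sym xyh.
have [c [s [cc fs [c0 c1] s0 s1]]] := continued_trans xyg xyh.
have := flat_loop scE cc c0 c1 fs.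
by rewrite s0 s1 => gh; apply: (mulIg h^-1%g); rewrite -gh mulgV.
Qed.

(** The monodromy theorem: the value at [y] is that of any continuation from a
    fixed base point. Near [x], a short path inside the domain of the local
    section [t x] continues by [t x y], which is flatness. *)
Lemma flat_section : simply_connected R E -> locally_path_connected R E ->
  exists s, flat t setT s.
Proof.
move=> scE lE.
have [[x0 _]|E0] := pselect ([set: E] !=set0); last first.
  by exists (fun=> 1%g) => x; case: E0; exists x.
have [s xs] := choice (fun x => continued_exists x0 x scE).
exists s => x _.
have [N [oN Nx] fN] := flat_local x ct.
have [U [[oU Ux] pU UN]] := lE x N (open_nbhs_nbhs (conj oN Nx)).
apply: filterS (open_nbhs_nbhs (conj oU Ux)) => y Uy _.
apply: (continued_uniq scE (xs y)); apply: (continued_trans (xs x)).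
have [c [cc c0 c1] cU] := pU x y Ux Uy.
have cc' : continuous (c \o clamp).
  exact: continuous_retract cc clamp_continuous clamp_unit.
exists (c \o clamp), (t x \o (c \o clamp)); split.
- exact: cc'.
- apply: flat_comp cc' _ fN => a _; apply: UN; apply: cU.
  by exists (clamp a) => //; exact: clamp_unit.
- by rewrite /= !clamp_id.
- by rewrite /= !clamp_id // c0 cocycle_refl.
- by rewrite /= !clamp_id // c1.
Qed.

End Continuation.
End Paths.

(** * Coverings of an open subset *)

Section Coverings.
Variables (M : topologicalType) (A : set M).

Lemma set_val_embedding : embedding (@set_val M A).
Proof. by split=> [|U]; [exact: val_inj|]. Qed.

Lemma range_set_val : range (@set_val M A) = A.
Proof.
apply/seteqP; split=> [_ [x _ <-]|x Ax]; first exact: set_valP.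
by exists (SigSub (mem_set Ax)).
Qed.

Hypothesis oA : open A.

Lemma set_val_open_at x : open_at (@set_val M A) x.
Proof.
by apply: embedding_open_at set_val_embedding _ _; rewrite range_set_val.
Qed.

Variables (E : topologicalType) (pi : E -> set_type A).
Hypothesis cpi : covering_map pi.
Let q := set_val \o pi.

Lemma covering_open_at e : open_at q e.
Proof.
apply: open_at_comp; last exact: set_val_open_at.
have [_ _ /(_ (pi e))[U [oU Ue] [F [FU _ Fh]]]] := cpi.
have : (\bigcup_(V in F) V) e by rewrite FU.
by move=> [V FV Ve]; exact: open_homeo_on_open_at (Fh _ FV).1 Ve.
Qed.

Lemma covering_surjective m : A m -> exists e, q e = m.
Proof.
move=> Am; have [_ ran _] := cpi.
have : range pi (SigSub (mem_set Am)) by rewrite ran.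
by move=> [e _ pe]; exists e; rewrite /q /= pe.
Qed.

(** The form in which evenly covered neighborhoods are used: one neighborhood
    [O] of [m] carries a continuous section through every point above [O]. The
    last clause says that the section inverts the projection near [e], which
    makes its image a neighborhood of [e]. *)
Lemma covering_section m : A m ->
  exists2 O, open_nbhs m O & forall e, O (q e) ->
    exists s : M -> E, [/\ forall n, O n -> {for n, continuous s},
      forall n, O n -> q (s n) = n, s (q e) = e &
      \forall x \near e, s (q x) = x].
Proof.
move=> Am; have [_ _ /(_ (SigSub (mem_set Am)))] := cpi.
move=> [U [oU Um] [F [FU _ Fh]]].
have oO : open (set_val @` U).
  rewrite openE => _ [u Uu <-]; apply: set_val_open_at.
  exact: open_nbhs_nbhs.
exists (set_val @` U); first by split=> //; exists (SigSub (mem_set Am)).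
move=> e [u Uu qe].
have pe : pi e = u by apply: val_inj.
have : (\bigcup_(V in F) V) e by rewrite FU /= pe.
move=> [V FV Ve]; have [hV pV] := Fh _ FV.
have [oV _ injV _] := hV.
have qinj x y : V x -> V y -> q x = q y -> x = y.
  by move=> Vx Vy /val_inj; apply: injV; exact: mem_set.
pose s n := xget e [set x | V x /\ q x = n].
have sP n : (set_val @` U) n -> V (s n) /\ q (s n) = n.
  rewrite -pV => -[_ [x Vx <-] <-].
  have ex : exists y, [set y | V y /\ q y = q x] y by exists x.
  exact: (xgetPex e ex).
have Oqe : (set_val @` U) (q e) by exists u.
have sq x : V x -> s (q x) = x.
  move=> Vx; have [] := sP (q x); last by move=> Vs qs; exact: qinj.
  by exists (pi x) => //; rewrite -pV; exists x.
exists s; split.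
- move=> n On B nB; have [Vs qs] := sP _ On.
  have nVB : nbhs (s n) (V `&` B).
    by apply: filterI => //; exact: open_nbhs_nbhs.
  have := covering_open_at nVB; rewrite qs => nI.
  have nO : nbhs n (set_val @` U) by exact: open_nbhs_nbhs.
  apply: (filterS2 _ _ nI nO) => k [x [Vx Bx] qx] Ok.
  have [Vsk qsk] := sP _ Ok.
  by rewrite /preimage /= (qinj (s k) x) // qsk.
- by move=> n /sP[].
- exact: sq.
- by apply: filterS (open_nbhs_nbhs (conj oV Ve)) => x; exact: sq.
Qed.

End Coverings.

(** * Developing maps *)

Section DevelopingMaps.
Variables (R : realType) (X : topologicalType) (G : groupType).
Variable act : G -> X -> X.
Hypothesis hGX : analytical_structure R act.

(** [D] is a developing map for the structure pulled back along [q]; no atlas on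
    [E] is involved. *)
Definition develops (E M : topologicalType) (AM : set (chart X M)) (q : E -> M)
    (D : E -> X) : Prop :=
  forall e c, AM c -> c.1 (q e) ->
    exists g, \forall y \near e, D y = act g (c.2 (q y)).

(** Choosing a chart at the image of each point [e] gives local developing maps
    [phi e]. They differ by elements of [G], unique by rigidity, which form a
    cocycle; a flat section [s] of it is exactly a choice of multipliers for
    which the [act (s e) (phi e)] fit together. *)
Lemma developing_map_simply_connected (E M : topologicalType)
    (AM : set (chart X M)) (q : E -> M) :
  ae_structure act AM ->
  simply_connected R E -> locally_path_connected R E ->
  continuous q -> (forall e, open_at q e) ->
  (forall e, atlas_domain AM (q e)) ->
  exists D, develops AM q D.
Proof.
move=> [chM compM _] scE lE cq oq Mq.
have /choice[c cP] e : exists c, AM c /\ c.1 (q e).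
  by have [c Ac cq'] := Mq e; exists c.
pose phi e y := (c e).2 (q y).
have near_dom e e' : (c e).1 (q e') -> \forall y \near e', (c e).1 (q y).
  move=> ce; have [oc _ _ _] := chM _ (cP e).1.
  by apply: near_comp; [exact: cq|exact: open_nbhs_nbhs].
have phi_open e : open_at (phi e) e.
  apply: (open_at_comp (oq e)).
  exact: open_homeo_on_open_at (chM _ (cP e).1) (cP e).2.
pose t e e' :=
  xget 1%g [set g | \forall y \near e', phi e y = act g (phi e' y)].
have tP e e' : (c e).1 (q e') ->
    \forall y \near e', phi e y = act (t e e') (phi e' y).
  move=> ce; have [g gP] := compM _ _ (cP e').1 (cP e).1 _ (cP e').2 ce.
  have ex : exists g,
      [set g | \forall y \near e', phi e y = act g (phi e' y)] g.
    by exists g; exact: near_comp (cq e') gP.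
  exact: (xgetPex 1%g ex).
have ct : cocycle t.
  move=> e; apply: filterS (near_dom _ _ (cP e).2) => e' ce.
  near=> e''.
  have ce'' : (c e).1 (q e'') by near: e''; exact: near_dom.
  have c'e'' : (c e').1 (q e'').
    by near: e''; apply: near_dom; exact: (cP e').2.
  have n1 : \forall y \near e'', phi e y = act (t e e') (phi e' y).
    by near: e''; apply: nbhs_interior; exact: tP.
  apply: (germ_unique hGX (phi_open e'')).
  apply: (filterS3 _ _ n1 (tP _ _ ce'') (tP _ _ c'e'')) => y -> /= <-.
  by move=> ->; rewrite (an_actM hGX).
have [s fs] := flat_section ct scE lE.
exists (fun e => act (s e) (phi e e)) => e d Ad de.
have [g gP] := compM _ _ Ad (cP e).1 _ de (cP e).2.
exists (s e * g)%g; near=> y.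
have -> : s y = (s e * t e y)%g.
  by near: y; apply: filterS (fs e I) => y'; apply.
have cy : (c e).1 (q y) by near: y; apply: near_dom; exact: (cP e).2.
rewrite !(an_actM hGX) -(nbhs_singleton (tP _ _ cy)); congr act.
by rewrite /phi; near: y; exact: near_comp (cq e) gP.
Unshelve. all: by end_near. Qed.

Lemma develops_continuous (E M : topologicalType) (AM : set (chart X M))
    (q : E -> M) (D : E -> X) e :
  (forall c, AM c -> is_chart c) -> {for e, continuous q} ->
  atlas_domain AM (q e) -> develops AM q D -> {for e, continuous D}.
Proof.
move=> chM cq [c Ac ce] /(_ e c Ac ce)[g gP] B.
rewrite (nbhs_singleton gP) => nB.
have cD : {for e, continuous (act g \o (c.2 \o q))}.
  apply: continuous_comp; last exact: (an_continuous hGX).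
  apply: continuous_comp; first exact: cq.
  exact: open_homeo_on_continuous (chM _ Ac) ce.
by apply: (filterS2 _ _ gP (near_comp cD nB)) => y; rewrite /preimage /= => ->.
Qed.

(** An a.e. morphism satisfies the relation with the charts only on some portly
    set. Rigidity spreads it over a connected neighborhood of every point of
    the covering, so that [D] develops along the whole of [E]. *)
Lemma develops_cover (M : topologicalType) (AM : set (chart X M))
    (E T : topologicalType) (AT : set (chart X T)) (p : T -> M) (j : E -> T)
    (D : T -> X) :
  ae_structure act AM -> locally_connected E ->
  embedding j -> open (range j) -> (forall e, open_at (p \o j) e) ->
  ae_morphism act AT AM p -> ae_morphism act AT (@model_atlas X) D ->
  develops AM (p \o j) (D \o j).
Proof.
move=> [chM _ _] lE ej orj oq.
move=> [cp [U [V [pU UT pV VM [UV mp]]]]] [cD [U' [V' [pU' _ _ _ [_ mD]]]]].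
move=> e d Ad de.
have cj := embedding_continuous ej.
have cq : continuous (p \o j).
  by move=> x; apply: continuous_comp; [exact: cj|exact: cp].
have [od _ _ _] := chM _ Ad.
have [N [[oN Ne] cN Nd]] : exists N, [/\ open_nbhs e N, connected N &
    N `<=` (p \o j) @^-1` d.1].
  apply: lE; apply: near_comp; first exact: cq.
  exact: open_nbhs_nbhs.
pose W := U `&` U'.
have [oW dW cW] : portly W by exact: portlyI.
have ojN : open (j @` N).
  rewrite openE => _ [x Nx <-]; apply: embedding_open_at => //.
  exact: open_nbhs_nbhs.
have NW : N `&` j @^-1` W = j @^-1` (j @` N `&` W).
  apply/seteqP; split=> x [].
    by move=> Nx Wx; split=> //; exists x.
  by move=> [y Ny /ej.1 <-].
have [] := @rigidity _ _ _ _ hGX _ (d.2 \o (p \o j)) (D \o j) N (j @^-1` W).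
- rewrite NW; apply: embedding_preimage_connected => //.
    by apply: cW => //; apply: image_connected => // x _; exact: cj.
  by move=> _ [[x _ <-] _]; exists x.
- move=> z Nz B; rewrite nbhsE => -[O [oO Oz] OB].
  have : (j @` (O `&` N) `&` W) !=set0.
    apply: dW; first by exists (j z), z.
    rewrite openE => _ [x ONx <-]; apply: embedding_open_at => //.
    by apply: open_nbhs_nbhs; split=> //; exact: openI.
  move=> [_ [[x [Ox Nx] <-] Wx]]; exists x; split; last exact: OB.
  by split.
- move=> z Nz; apply: continuous_comp; first exact: cq.
  exact: open_homeo_on_continuous (chM _ Ad) (Nd _ Nz).
- by move=> z Nz; apply: continuous_comp; [exact: cj|exact: cD].
- move=> z [Nz _]; apply: open_at_comp; first exact: oq.
  exact: open_homeo_on_open_at (chM _ Ad) (Nd _ Nz).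
- move=> z [Nz [Uz U'z]].
  have [c Ac cz] := UT _ Uz.
  have [g gP] := mp _ _ _ Uz Ac cz Ad (Nd _ Nz).
  have [h hP] := mD _ c ([set: X], idfun) U'z Ac cz erefl I.
  exists (h * g^-1)%g.
  apply: (filterS2 _ _ (near_comp (cj z) gP) (near_comp (cj z) hP)).
  move=> y [_ _ dy] [_ _ Dy].
  rewrite /= (an_actM hGX) dy (actK hGX).
  exact: Dy.
- move=> g gP; exists g.
  by apply: filterS (open_nbhs_nbhs (conj oN Ne)) => y /gP.
Qed.

End DevelopingMaps.

(** * Extension by continuity from a dense subspace *)

Definition extends_near (E T X : topologicalType) (j : E -> T) (D : E -> X)
    (x : T) : Prop :=
  exists C (DC : T -> X), [/\ open_nbhs x C,
    forall y, C y -> {for y, continuous DC} &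
    forall e, C (j e) -> DC (j e) = D e].

(** Local extensions agree where they overlap, by density of [E], so they glue. *)
Lemma extension_glue (E T X : topologicalType) (j : E -> T) (D : E -> X) :
  hausdorff_space X -> dense (range j) ->
  (forall x, extends_near j D x) ->
  exists2 D' : T -> X, continuous D' & D' \o j =1 D.
Proof.
move=> hX dj /choice[C /choice[DC CP]].
have CE x y : C x y -> DC y y = DC x y.
  have [[oCx _] cx ex] := CP x; have [[oCy Cyy] cy ey] := CP y => Cxy.
  apply: (@hausdorff_eq_closure _ _ _ _ (range j `&` (C x `&` C y))) => //.
  - move=> A; rewrite nbhsE => -[O [oO Oy] OA].
    have oOC := openI oO (openI oCx oCy).
    have [|z [[Oz Cz] jz]] := dj _ _ oOC; first by exists y.
    by exists z; split; [|exact: OA].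
  - exact: cy.
  - exact: cx.
  - by move=> _ [[e _ <-] [Cxe Cye]]; rewrite ex // ey.
exists (fun x => DC x x); last first.
  by move=> e; have [[_ ?] _ ext] := CP (j e); exact: ext.
move=> x A nA; have [[oC Cx] cx _] := CP x.
apply: (filterS2 _ _ (open_nbhs_nbhs (conj oC Cx)) (cx _ Cx A nA)) => y Cxy.
by rewrite /preimage /= (CE x y).
Qed.

(** * Extension at the points above a model neighborhood *)

(** Intersecting the sets of a countable base one after the other, inside
    connected neighborhoods. A set [C] of the base is recovered as [b (f C)]
    from its code [f C]. *)
Lemma decreasing_base (T : topologicalType) (x : T) (A : set T) :
  first_countable T -> locally_connected T -> nbhs x A ->
  exists W : nat -> set T, [/\ forall n, open_nbhs x (W n),
    forall n, connected (W n), W 0 `<=` A,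
    forall m n, (m <= n)%N -> W n `<=` W m &
    forall B, nbhs x B -> exists n, W n `<=` B].
Proof.
move=> /(_ x)[B cB xB] lT nA.
have /(@pcard_injP)[f] := cB; rewrite /= => finj.
pose b n := xget setT [set C | B C /\ f C = n].
have nb n : nbhs x (b n).
  rewrite /b; case: xgetP => [C _ [BC _]|_]; last exact: filterT.
  by rewrite xB; exists C.
have bf C : B C -> b (f C) = C.
  move=> BC; rewrite /b; case: xgetP => [C' _ [BC' fC]|/(_ C)[]//].
  by apply: finj => //; exact: mem_set.
pose nice (V : set T) := open_nbhs x V /\ connected V.
have shrink V C : nbhs x V -> nbhs x C -> exists V', nice V' /\ V' `<=` V `&` C.
  move=> nV nC; have [V' [oV' cV' V'VC]] := lT _ _ (filterI nV nC).
  by exists V'.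
have /choice[g gP] : forall VC : set T * set T, exists V',
    nbhs x VC.1 -> nbhs x VC.2 -> nice V' /\ V' `<=` VC.1 `&` VC.2.
  move=> [V C] /=; have [nV|nV] := pselect (nbhs x V); last by exists V.
  have [nC|nC] := pselect (nbhs x C); last by exists V.
  by have [V' ?] := shrink V C nV nC; exists V'.
pose W := nat_rect (fun=> set T) (g (A, b 0)) (fun n V => g (V, b n.+1)).
have nice_nbhs V : nice V -> nbhs x V by move=> [/open_nbhs_nbhs].
have W0 : nice (W 0) /\ W 0 `<=` A `&` b 0 by exact: (gP (A, b 0) nA (nb 0)).
have Wn n : nice (W n).
  elim: n => [|n IH]; first exact: W0.1.
  exact: (gP (_, _) (nice_nbhs _ IH) (nb _)).1.
have WS n : W n.+1 `<=` W n `&` b n.+1.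
  exact: (gP (_, _) (nice_nbhs _ (Wn n)) (nb n.+1)).2.
have Wb n : W n `<=` b n by case: n => [z /W0.2[]//|n z /WS[]].
exists W; split.
- by move=> n; have [] := Wn n.
- by move=> n; have [] := Wn n.
- by move=> z /W0.2[].
- move=> m n /subnK <-; elim: (n - m)%N => [//|k IH] z.
  by rewrite addSn => /WS[/IH].
- move=> C; rewrite xB => -[C' BC' CC']; exists (f C').
  by apply: subset_trans CC'; rewrite -[X in _ `<=` X](bf C').
Qed.

Section SingularExtension.
Variables (R : realType) (X : topologicalType) (G : groupType).
Variable act : G -> X -> X.
Hypothesis hGX : analytical_structure R act.

(** [j : E -> Mt] and [p : Mt -> M] form the branched cover of the manifold, and
    [D] is a developing map on its unbranched part. *)
Variables (M Mt E : topologicalType) (AM : set (chart X M)).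
Variables (p : Mt -> M) (j : E -> Mt) (D : E -> X).
Hypotheses (fcM : first_countable M) (lcM : locally_connected M).
Hypotheses (lcMt : locally_connected Mt) (lcE : locally_connected E).
Hypotheses (cp : continuous p) (ej : embedding j) (pj : portly (range j)).
Let q := p \o j.
Hypothesis oq : forall e, open_at q e.
Hypothesis sq : forall e, exists2 O, open_nbhs (q e) O & exists s : M -> E,
  [/\ forall n, O n -> {for n, continuous s}, forall n, O n -> q (s n) = n,
      s (q e) = e & \forall x \near e, s (q x) = x].
Hypothesis chM : forall c, AM c -> is_chart c.
Hypothesis regM : forall e, atlas_domain AM (q e).
Hypothesis DM : develops act AM q D.

(** The same data for the model; here the developing map [Dn] is already defined
    on the whole of the branched cover [Nt]. *)
Variables (N Nt F : topologicalType) (AN : set (chart X N)).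
Variables (pn : Nt -> N) (jn : F -> Nt) (Dn : Nt -> X).
Hypotheses (hN : hausdorff_space N) (lcN : locally_connected N).
Hypotheses (csN : complete_spread pn) (cjn : continuous jn).
Let qn := pn \o jn.
Hypothesis cDn : continuous Dn.
Hypothesis chN : forall c, AN c -> is_chart c.
Hypothesis DN : develops act AN qn (Dn \o jn).
Hypothesis qn_surj : forall n, atlas_domain AN n -> exists e, qn e = n.
Hypothesis sn : forall n, atlas_domain AN n ->
  exists2 O, open_nbhs n O & forall e, O (qn e) ->
    exists s : N -> F, [/\ forall m, O m -> {for m, continuous s},
      forall m, O m -> qn (s m) = m & s (qn e) = e].

(** [h] identifies the open set [U] with an open set of the model, and respects
    the structures over the portly subset [U0] of [U]. *)
Variables (U U0 : set M) (h : M -> N).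
Hypothesis hU : open_homeo_on U h.
Hypotheses (oU0 : open U0) (U0U : U0 `<=` U) (U0d : U `<=` closure U0).
Hypothesis U0c : forall W, open W -> W `<=` U -> connected W ->
  connected (W `&` U0).
Hypothesis regN : forall x, U0 x -> atlas_domain AN (h x).
Hypothesis hgx : forall x c d, U0 x -> AM c -> c.1 x -> AN d -> d.1 (h x) ->
  exists g, \forall y \near x, d.2 (h y) = act g (c.2 y).

Let oU : open U. Proof. by have [] := hU. Qed.

Let cj : continuous j. Proof. exact: embedding_continuous. Qed.

Let cq : continuous q.
Proof. by move=> e; apply: continuous_comp; [exact: cj|exact: cp]. Qed.

Let ch x : U x -> {for x, continuous h}.
Proof. exact: open_homeo_on_continuous. Qed.

Let oh x : U x -> open_at h x.
Proof. exact: open_homeo_on_open_at. Qed.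

Let ohW W : open W -> W `<=` U -> open (h @` W).
Proof. by have [_ _ _ H] := hU => oW WU; exact: H. Qed.

Let cD e : {for e, continuous D}.
Proof. exact: (develops_continuous hGX chM (@cq e) (regM e) DM). Qed.

Definition cell (W : set M) (x : Mt) := connected_component (p @^-1` W) x.
Definition model_cell (W : set M) (x : Nt) :=
  connected_component (pn @^-1` (h @` W)) x.

Lemma cell_open W x : open W -> open (cell W x).
Proof.
by move=> oW; apply: open_connected_component => //; apply: open_comp.
Qed.

Lemma cell_refl (W : set M) x : W (p x) -> cell W x x.
Proof. by move=> Wx; exact: connected_component_refl. Qed.

Lemma cell_sub W x y : cell W x y -> W (p y).
Proof. by move=> /connected_component_sub. Qed.

(** [D] is controlled only at the points [e] of [E] above [U0]; these are dense in
    the branched cover above [U]. *)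
Lemma cell_dense K x : open K -> K x -> U (p x) ->
  exists2 e, K (j e) & U0 (q e).
Proof.
move=> oK Kx Ux; have [_ dj _] := pj.
have oKU : open (K `&` p @^-1` U) by apply: openI => //; exact: open_comp.
have [|y [[Ke Ue] [e _ ee]]] := dj _ _ oKU; first by exists x.
rewrite -ee in Ke Ue.
have nK : nbhs e (j @^-1` K) by apply: cj; exact: open_nbhs_nbhs.
have [m [Um [e' Ke' qe']]] := U0d Ue (oq nK).
by exists e' => //; rewrite qe'.
Qed.

Section Translate.
Variable g0 : G.

(** The points [e] and [f] lie over points that correspond under [h], in [C] and
    [Q] respectively, and the germs of [D] and of the translate by [g0] of [Dn]
    correspond as well. The common germ is factored through a map [phi] on the
    model, so that it can be moved along any local section of the cover of the
    model. *)
Definition matched (C : set Mt) (Q : set Nt) (e : E) (f : F) : Prop :=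
  [/\ C (j e), U0 (q e), Q (jn f), qn f = h (q e) &
    exists phi : N -> X, (\forall y \near f, Dn (jn y) = phi (qn y)) /\
      (\forall y \near e, D y = act g0 (phi (h (q y))))].

Lemma matched_value C Q e f : matched C Q e f -> D e = act g0 (Dn (jn f)).
Proof.
move=> [_ _ _ qe [phi [/nbhs_singleton -> /nbhs_singleton ->]]].
by rewrite qe.
Qed.

(** Sections of the covering carry connected pieces of [U0] to [E], so that the
    part of the cell above [U0] is locally, hence globally, connected. *)
Lemma cell_connected W x : open W -> W `<=` U ->
  connected (j @^-1` (cell W x) `&` q @^-1` U0).
Proof.
move=> oW WU; have oC := cell_open x oW.
have oK : open (j @^-1` (cell W x)) by apply: open_comp => // ? _; exact: cj.
apply: connected_dense_local => //.
- by apply: portly_range_preimage => //; exact: component_connected.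
- move=> e Ce B; rewrite nbhsE => -[O [oO Oe] OB].
  have nK : nbhs e (O `&` j @^-1` cell W x).
    by apply: open_nbhs_nbhs; split=> //; exact: openI.
  have [m [Um [e' [Oe' Ce'] qe']]] := U0d (WU _ (cell_sub Ce)) (oq nK).
  by exists e'; split; [rewrite /= qe'|exact: OB].
- move=> e Ce; have [O [oO Oe] [s [cs qs se sx]]] := sq e.
  have nK : nbhs (q e) (s @^-1` (j @^-1` cell W x)).
    by apply: cs => //; rewrite se; exact: open_nbhs_nbhs.
  have nW : nbhs (q e) (O `&` W).
    apply: open_nbhs_nbhs; split; first exact: openI.
    by split=> //; exact: cell_sub Ce.
  have [V [[oV Ve] cV VK]] := lcM (filterI nK nW).
  exists (s @` (V `&` U0)); split.
  + apply: image_connected; first by move=> n [/VK[_ [On _]] _]; exact: cs.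
    by apply: U0c => // n /VK[_ [_ /WU]].
  + move=> _ [n [/VK[/= Kn [On _]] U0n] <-]; split=> //=.
    by rewrite qs.
  + have nV : nbhs e (q @^-1` V) by apply: cq; exact: open_nbhs_nbhs.
    apply: (filterS2 _ _ sx nV) => y sy Vy U0y.
    by exists (q y).
Qed.

(** Above an evenly covered neighborhood of [h (q e)], compose the section through
    the partner [f1] of [e1] with [h \o q]: this gives every nearby [e2] a partner
    in the same component. Both [D] and [Dn] transported by this lift develop
    the same structure, so they differ by one element of [G], which is [g0] as
    it is so at [e1]. *)
Lemma matched_local W x xi e : open W -> W `<=` U ->
  cell W x (j e) -> U0 (q e) ->
  exists2 V, nbhs e V & forall e1 e2, V e1 -> V e2 ->
    (exists f, matched (cell W x) (model_cell W xi) e1 f) ->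
    exists f, matched (cell W x) (model_cell W xi) e2 f.
Proof.
move=> oW WU Ce U0e.
have [O [oO Oy] sO] := sn (regN U0e).
have [d Ad dy] := regN U0e.
have [od _ _ _] := chN Ad.
have Ue := U0U U0e.
have nO : nbhs (h (q e)) (O `&` (d.1 `&` h @` W)).
  apply: open_nbhs_nbhs; split.
    by apply: openI => //; apply: openI => //; exact: ohW.
  by split=> //; split=> //; exists (q e) => //; exact: cell_sub Ce.
have [O' [[oO' O'y] cO' O'O]] := lcN nO.
have chq : {for e, continuous (h \o q)}.
  by apply: continuous_comp; [exact: cq|exact: ch].
have nV : nbhs e ((h \o q) @^-1` O' `&` (q @^-1` U0 `&` j @^-1` cell W x)).
  apply: filterI; first by apply: chq; exact: open_nbhs_nbhs.
  apply: filterI; first by apply: cq; exact: open_nbhs_nbhs.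
  by apply: cj; apply: open_nbhs_nbhs; split=> //; exact: cell_open.
have [V [[oV Ve] cV VP]] := lcE nV.
exists V; first exact: open_nbhs_nbhs.
move=> e1 e2 Ve1 Ve2 [f1 [Ce1 U0e1 Qf1 qf1 [phi1 [Dphi1 phiD1]]]].
have [O'e1 _] := VP _ Ve1.
have Of1 : O (qn f1) by rewrite qf1; exact: (O'O _ O'e1).1.
have [s [cs qs sf1]] := sO _ Of1.
pose u y := s (h (q y)).
have cu y : V y -> {for y, continuous u}.
  move=> Vy; have [O'y' [U0y _]] := VP _ Vy.
  apply: (@continuous_comp _ _ _ (h \o q) s).
    by apply: continuous_comp; [exact: cq|apply: ch; exact: U0U].
  by apply: cs; exact: (O'O _ O'y').1.
have qu y : V y -> qn (u y) = h (q y).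
  by move=> Vy; apply: qs; exact: (O'O _ (VP _ Vy).1).1.
have ue1 : u e1 = f1 by rewrite /u -qf1.
pose D' := Dn \o jn \o u.
have nVy y : V y -> nbhs y V by move=> Vy; exact: open_nbhs_nbhs.
have D'germ y : V y -> exists k, \forall z \near u y,
    Dn (jn z) = act k (d.2 (qn z)).
  move=> Vy; apply: DN => //; rewrite qu //.
  exact: (O'O _ (VP _ Vy).1).2.1.
have D'near y k : V y ->
    (\forall z \near u y, Dn (jn z) = act k (d.2 (qn z))) ->
    \forall z \near y, D' z = act k (d.2 (h (q z))).
  move=> Vy kP; apply: (filterS2 _ _ (nVy _ Vy) (near_comp (cu _ Vy) kP)).
  by move=> z Vz; rewrite /D' /= qu.
have dhq_open y : V y -> open_at (d.2 \o (h \o q)) y.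
  move=> Vy; have [O'y' [U0y _]] := VP _ Vy.
  apply: open_at_comp.
    by apply: open_at_comp; [exact: oq|apply: oh; exact: U0U].
  apply: open_homeo_on_open_at (chN Ad) _.
  exact: (O'O _ O'y').2.1.
have D'open y : V y -> open_at D' y.
  move=> Vy; have [k kP] := D'germ _ Vy.
  have := open_at_comp (dhq_open _ Vy) (@act_open_at _ _ _ _ hGX k _).
  by apply: open_at_near; exact: D'near kP.
have [k kP] : exists k, forall y, V y -> D y = act k (D' y).
  apply: (rigidity hGX (W := setT)); rewrite ?setIT //.
  - exact: subset_closure.
  - move=> y Vy; apply: (@continuous_comp _ _ _ u (Dn \o jn)); first exact: cu.
    by apply: continuous_comp; [exact: cjn|exact: cDn].
  - move=> y Vy; have [O'y' [U0y _]] := VP _ Vy.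
    have [c Ac cy] := regM y.
    have [g gP] := DM Ac cy.
    have dhy : d.1 (h (q y)) by exact: (O'O _ O'y').2.1.
    have [g' g'P] := hgx U0y Ac cy Ad dhy.
    have [k kP] := D'germ _ Vy.
    exists (g * g'^-1 * k^-1)%g.
    apply: (filterS3 _ _ gP (near_comp (cq (x := y)) g'P) (D'near _ _ Vy kP)).
    move=> z -> hz ->; rewrite !(an_actM hGX) (actK hGX) hz.
    by rewrite (actK hGX).
(* the germs at [e1] are related by [g0] by assumption and by [k] *)
have kg0 : k = g0.
  apply: (germ_unique hGX (D'open _ Ve1)).
  have phiu : \forall y \near e1, D' y = phi1 (qn (u y)).
    have := @near_comp _ _ u e1 (fun z => Dn (jn z) = phi1 (qn z)) (cu _ Ve1).
    by rewrite ue1; apply.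
  apply: (filterS3 _ _ (nVy _ Ve1) phiD1 phiu) => y Vy Dy D'y.
  by rewrite -kP // Dy D'y qu.
have [k' k'P] := D'germ _ Ve2.
exists (u e2); split.
- by have [_ []] := VP _ Ve2.
- by have [_ []] := VP _ Ve2.
- apply: (connected_component_trans Qf1).
  apply: (@connected_component_max _ _ (jn @` (s @` O'))).
  + by exists f1 => //; exists (qn f1) => //; rewrite qf1.
  + move=> _ [_ [m O'm <-] <-]; have [Om [_ hWm]] := O'O _ O'm.
    by rewrite /= -[pn _]/(qn _) qs.
  + apply: image_connected; first by move=> *; exact: cjn.
    by apply: image_connected => // m /O'O[Om _]; exact: cs.
  + exists (u e2) => //; exists (h (q e2)) => //.
    exact: (VP _ Ve2).1.
- exact: qu.
- exists (act k' \o d.2); split; first exact: k'P.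
  apply: (filterS2 _ _ (nVy _ Ve2) (D'near _ _ Ve2 k'P)) => y Vy D'y.
  by rewrite kP // kg0 D'y.
Qed.

(** A single matched pair in two cells forces every value of [D] on the first one,
    above [U0], to be the translate of a value of [Dn] on the second one. Path
    lifting is replaced by the connectedness of the first cell, and no lift of
    the whole cell to [F] is claimed: in general there is none, as the cell may
    have loops that are essential in the model. *)
Lemma matched_spread W x xi e e' f : open W -> W `<=` U ->
  matched (cell W x) (model_cell W xi) e f -> cell W x (j e') -> U0 (q e') ->
  exists f', matched (cell W x) (model_cell W xi) e' f'.
Proof.
move=> oW WU mf Ce' U0e'; have [Ce U0e _ _ _] := mf.
have cP := (connected_constP _).1 (cell_connected (x := x) oW WU).
pose P (y : E) := exists f', matched (cell W x) (model_cell W xi) y f'.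
apply: (cP P _ e e' (conj Ce U0e) (conj Ce' U0e')); last by exists f.
move=> y [Cy U0y]; have [V nV VP] := matched_local xi oW WU Cy U0y.
apply: (filterS _ nV) => z Vz _; split; apply: VP => //; exact: nbhs_singleton.
Qed.

Lemma model_cell_refl (W : set M) f e : qn f = h (q e) -> W (q e) ->
  model_cell W (jn f) (jn f).
Proof.
move=> qf We; apply: connected_component_refl.
by rewrite /= -[pn _]/(qn f) qf; exists (q e).
Qed.

Lemma model_cell_mono (W W' : set M) xi eta : W `<=` W' ->
  model_cell W xi eta -> model_cell W' xi eta.
Proof.
move=> WW'; apply: connected_component_mono.
by apply: preimage_subset; exact: image_subset.
Qed.

Lemma cell_mono (W W' : set M) x y : W `<=` W' -> cell W x y -> cell W' x y.
Proof.
by move=> WW'; apply: connected_component_mono; exact: preimage_subset.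
Qed.

Definition cells_match (W : set M) (x : Mt) (xi : Nt) : Prop :=
  exists e f, matched (cell W x) (model_cell W xi) e f.

(** Corresponding points whose neighborhoods match at every scale: this is what
    makes [act g0 (Dn xi)] the limit of [D] at [x]. *)
Definition adapted (x : Mt) (xi : Nt) : Prop :=
  pn xi = h (p x) /\
  forall W, open W -> W `<=` U -> W (p x) -> cells_match W x xi.

(** The partner of a point of the smaller cell, found in the larger component,
    selects a component of the smaller preimage. *)
Lemma cells_match_shrink W W' x xi :
  open W -> W `<=` U -> open W' -> W' `<=` W ->
  W' (p x) -> cells_match W x xi ->
  exists e f, model_cell W xi (jn f) /\
    matched (cell W' x) (model_cell W' (jn f)) e f.
Proof.
move=> oW WU oW' W'W W'x [e [f mf]].
have [e' Ce' U0e'] :=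
  cell_dense (cell_open x oW') (cell_refl W'x) (WU _ (W'W _ W'x)).
have [f' mf'] := matched_spread oW WU mf (cell_mono W'W Ce') U0e'.
exists e', f'; have [_ _ Qf' qf' phi] := mf'; split=> //; split=> //.
exact: model_cell_refl qf' (cell_sub Ce').
Qed.

(** Shrinking [W] along a countable base at [p x], pick matched pairs one after
    the other, each in the component selected by the previous one. The nested
    components thus chosen in the cover of the model extend to a choice [chi]
    for all connected neighborhoods of [h (p x)], and completeness of the spread
    provides a point common to all of them. *)
Lemma adapted_exists W x xi0 : open W -> W `<=` U -> W (p x) ->
  cells_match W x xi0 -> exists2 xi, model_cell W xi0 xi & adapted x xi.
Proof.
move=> oW WU Wx mW.
have nW : nbhs (p x) W by exact: open_nbhs_nbhs.
have [B [oB cB B0 Bmono Bbase]] := decreasing_base fcM lcM nW.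
have BW n : B n `<=` W by apply: subset_trans B0; exact: Bmono.
have BU n : B n `<=` U by exact: subset_trans WU.
have oBn n : open (B n) by have [] := oB n.
have Bx n : B n (p x) by have [] := oB n.
pose matched_at n f :=
  exists e, matched (cell (B n) x) (model_cell (B n) (jn f)) e f.
have [e0 [f0 [Wf0 matched0]]] :=
  cells_match_shrink oW WU (oBn 0) (BW 0) (Bx 0) mW.
have /choice[next nextP] : forall nf : nat * F, exists f',
    matched_at nf.1 nf.2 ->
    matched_at nf.1.+1 f' /\ model_cell (B nf.1) (jn nf.2) (jn f').
  move=> [n f] /=; have [[e mf]|] := pselect (matched_at n f); last by exists f.
  have [e' [f' [Bf' mf']]] := cells_match_shrink (oBn n) (BU n) (oBn n.+1)
    (Bmono _ _ (leqnSn n)) (Bx n.+1) (ex_intro _ e (ex_intro _ f mf)).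
  by exists f' => _; split=> //; exists e'.
pose f := nat_rect (fun=> F) f0 (fun n g => next (n, g)).
have fmatched n : matched_at n (f n).
  elim: n => [|n IH]; first by exists e0.
  exact: (nextP (n, f n) IH).1.
have fS n : model_cell (B n) (jn (f n)) (jn (f n.+1)).
  exact: (nextP (n, f n) (fmatched n)).2.
have frefl n : model_cell (B n) (jn (f n)) (jn (f n)).
  by have [e []] := fmatched n.
have fmn m n : (m <= n)%N -> model_cell (B m) (jn (f m)) (jn (f n)).
  move=> /subnK <-; elim: (n - m)%N => [//|k IH]; rewrite addSn.
  apply: (connected_component_trans IH).
  by apply: model_cell_mono (fS _); apply: Bmono; exact: leq_addl.
pose comp O n := connected_component (pn @^-1` O) (jn (f n)).
have compE O m n : h @` B m `<=` O -> h @` B n `<=` O -> comp O m = comp O n.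
  wlog mn : m n / (m <= n)%N.
    by move=> H mO nO; have [/H->//|/ltnW/H->] := leqP m n.
  move=> mO _; apply: same_connected_component.
  by apply: connected_component_mono (fmn _ _ mn); exact: preimage_subset.
pose chi (O : set N) : set Nt :=
  [set xi | exists2 n, h @` B n `<=` O & comp O n xi].
have chiE O n : h @` B n `<=` O -> chi O = comp O n.
  move=> nO; apply/seteqP; split=> [xi [m mO]|xi cxi]; last by exists n.
  by rewrite (compE _ _ _ mO nO).
have Ux : U (p x) by exact: WU.
have small O : open_nbhs (h (p x)) O -> exists n, h @` B n `<=` O.
  move=> oO; have [n nO] := Bbase _ (ch Ux (open_nbhs_nbhs oO)).
  by exists n => _ [m /nO ? <-].
have clx : closure (range pn) (h (p x)).
  move=> A; rewrite nbhsE => -[O oO OA]; have [n nO] := small O oO.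
  have [e [Ce _ _ qf _]] := fmatched n.
  exists (qn (f n)); split; first by exists (jn (f n)).
  by apply: OA; apply: nO; rewrite qf; exists (q e) => //; exact: cell_sub Ce.
have pnf n : (h @` B n) (pn (jn (f n))).
  have [e [Ce _ _ qf _]] := fmatched n.
  by rewrite -[pn _]/(qn (f n)) qf; exists (q e) => //; exact: cell_sub Ce.
have [_ /(_ _ clx chi)[||xi xiP]] := csN.
- move=> O oO cO; have [n nO] := small O oO; exists (jn (f n)).
    exact/nO/pnf.
  exact: chiE.
- move=> O O' oO cO oO' cO' OO'; have [n nO] := small O oO.
  rewrite (chiE _ _ nO) (chiE O' n); last exact: subset_trans OO'.
  by apply: connected_component_mono; exact: preimage_subset.
have xiB n : model_cell (B n) (jn (f n)) xi.
  have hBn : open_nbhs (h (p x)) (h @` B n).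
    by split; [exact: ohW|exists (p x)].
  have := xiP _ hBn; rewrite (chiE _ n) //; apply.
  by apply: image_connected => // m /BU; exact: ch.
exists xi.
  by apply: (connected_component_trans Wf0); exact: model_cell_mono (xiB 0).
split.
  apply/esym/hN => A C nA nC.
  have [O [oO cO OA]] := lcN nA.
  exists (pn xi); split; last exact: nbhs_singleton.
  apply: OA; have [n nO] := small O oO.
  by have := xiP _ oO cO; rewrite (chiE _ _ nO) => /connected_component_sub.
move=> W' oW' W'U W'x; have nW' : nbhs (p x) W' by exact: open_nbhs_nbhs.
have [n nW''] := Bbase _ nW'; have [e [Ce U0e Qf qf phi]] := fmatched n.
exists e, (f n); split=> //; first exact: cell_mono Ce.
apply: (model_cell_mono nW''); apply: connected_component_sym.
exact: xiB.
Qed.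

(** The defining property of a spread: components of preimages are arbitrarily
    small, and by continuity of [h] those of the preimages of open sets of the
    form [h @` W] suffice. *)
Lemma small_model_cell x xi A : U (p x) -> pn xi = h (p x) -> nbhs xi A ->
  exists W, [/\ open W, W `<=` U, W (p x) & model_cell W xi `<=` A].
Proof.
move=> Ux pxi nA; have [[_ [_ bas]] _] := csN.
have [C [[O oO [z Oz Cz]] Cxi] CA] := bas xi A nA.
have oW : open (U `&` h @^-1` O).
  rewrite openE => m [Um Om]; apply: filterI; first exact: open_nbhs_nbhs.
  by apply: ch => //; exact: open_nbhs_nbhs.
have zxi : connected_component (pn @^-1` O) z xi by rewrite -Cz.
exists (U `&` h @^-1` O); split=> //.
  split=> //; rewrite /preimage /= -pxi.
  exact: connected_component_sub zxi.
apply: subset_trans CA; rewrite Cz (same_connected_component zxi).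
by apply: connected_component_mono => w [m [_ Om] hm]; rewrite /= -hm.
Qed.

Lemma adapted_limit x xi A : U (p x) -> adapted x xi ->
  nbhs (act g0 (Dn xi)) A ->
  exists W, [/\ open W, W `<=` U, W (p x),
    model_cell W xi `<=` (act g0 \o Dn) @^-1` A &
    forall e, cell W x (j e) -> U0 (q e) -> A (D e)].
Proof.
move=> Ux [pxi ad] nA.
have nA' : nbhs xi ((act g0 \o Dn) @^-1` A).
  have cgD : {for xi, continuous (act g0 \o Dn)}.
    by apply: continuous_comp; [exact: cDn|exact: (an_continuous hGX)].
  exact: cgD.
have [W [oW WU Wx WA]] := small_model_cell Ux pxi nA'.
exists W; split=> // e Ce U0e; have [e' [f mf]] := ad W oW WU Wx.
have [f' mf'] := matched_spread oW WU mf Ce U0e.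
by rewrite (matched_value mf'); apply: WA; have [] := mf'.
Qed.

Lemma adapted_uniq x xi xi' : U (p x) -> adapted x xi -> adapted x xi' ->
  act g0 (Dn xi) = act g0 (Dn xi').
Proof.
move=> Ux ad ad'; have [hX _ _] := an_admissible hGX; apply: hX => A A' nA nA'.
have [W [oW WU Wx _ WA]] := adapted_limit Ux ad nA.
have [W' [oW' WU' Wx' _ WA']] := adapted_limit Ux ad' nA'.
have oWW := openI oW oW'.
have [e Ce U0e] := cell_dense (cell_open x oWW) (cell_refl (conj Wx Wx')) Ux.
exists (D e); split.
  by apply: WA => //; apply: cell_mono Ce; exact: subIsetl.
by apply: WA' => //; apply: cell_mono Ce; exact: subIsetr.
Qed.

(** Extend [D] by its limits, computed through adapted points. Continuity does not
    come from regularity of [X] but from the same argument run at nearby points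
    [y]: an adapted point for [y] can be found in the small component where
    [Dn] is already close to its value at the adapted point for [x]. *)
Lemma cells_match_extension x0 xi0 : U (p x0) -> cells_match U x0 xi0 ->
  extends_near j D x0.
Proof.
move=> Ux0 mU.
have UU : U `<=` U by [].
have cellE W x y : cell W x y -> cell W y = cell W x.
  by move=> Cy; apply/esym; exact: same_connected_component.
have /choice[xi xiP] : forall x, exists xi, cell U x0 x -> adapted x xi.
  move=> x; have [Cx|nCx] := pselect (cell U x0 x); last by exists xi0.
  have mx : cells_match U x xi0 by rewrite /cells_match (cellE _ _ _ Cx).
  by have [xi _ ad] := adapted_exists oU UU (cell_sub Cx) mx; exists xi.
exists (cell U x0), (fun x => act g0 (Dn (xi x))); split.
- by split; [exact: cell_open|exact: cell_refl].
- move=> x Cx A nA; have Ux := cell_sub Cx.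
  have [W [oW WU Wx WA _]] := adapted_limit Ux (xiP _ Cx) nA.
  have oC := cell_open x oW.
  apply: filterS (open_nbhs_nbhs (conj oC (cell_refl Wx))) => y Cy.
  have C0y : cell U x0 y by rewrite -(cellE _ _ _ Cx); exact: cell_mono Cy.
  have my : cells_match W y (xi x).
    by rewrite /cells_match (cellE _ _ _ Cy); exact: (xiP _ Cx).2.
  have [eta Weta ad] := adapted_exists oW WU (cell_sub Cy) my.
  rewrite /preimage /= (adapted_uniq (cell_sub C0y) (xiP _ C0y) ad).
  exact: WA.
- move=> e Ce; have [hX _ _] := an_admissible hGX; apply: hX => A A' nA nA'.
  have Ue := cell_sub Ce.
  have [W [oW WU We _ WA]] := adapted_limit Ue (xiP _ Ce) nA.
  have nK : nbhs e (j @^-1` cell W (j e) `&` D @^-1` A').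
    apply: filterI; last exact: cD.
    apply: cj; apply: open_nbhs_nbhs; split; first exact: cell_open.
    exact: cell_refl.
  have [m [Um [e' [Ce' Ae'] qe']]] := U0d Ue (oq nK).
  exists (D e'); split=> //; apply: WA => //.
  by rewrite qe'.
Qed.

End Translate.

(** The constant [g0] is read off at one pair of corresponding points. *)
Lemma cells_match_init x0 : U (p x0) -> exists g0 xi0, cells_match g0 U x0 xi0.
Proof.
move=> Ux0.
have [e Ce U0e] := cell_dense (cell_open x0 oU) (cell_refl Ux0) Ux0.
have [f qf] := qn_surj (regN U0e).
have [d Ad dqf] : atlas_domain AN (qn f) by rewrite qf; exact: regN.
have [c Ac cq0] := regM e.
have [k kP] := DN Ad dqf.
have [g gP] := DM Ac cq0.
rewrite qf in dqf; have [l lP] := hgx U0e Ac cq0 Ad dqf.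
exists (g * l^-1 * k^-1)%g, (jn f), e, f; split=> //.
  exact: model_cell_refl qf (U0U U0e).
exists (act k \o d.2); split; first exact: kP.
apply: (filterS2 _ _ gP (near_comp (cq (x := e)) lP)) => y -> ly.
by rewrite /= !(an_actM hGX) (actK hGX) ly (actK hGX).
Qed.

Lemma singular_extension x0 : U (p x0) -> extends_near j D x0.
Proof.
move=> /[dup] Ux0 /cells_match_init[g0 [xi0]].
exact: cells_match_extension.
Qed.

End SingularExtension.

(** * Local extensions and the structure of a branched cover *)

Section BranchedCovers.
Variables (R : realType) (X : topologicalType) (G : groupType).
Variable act : G -> X -> X.
Hypothesis hGX : analytical_structure R act.

(** Around a regular point the model is a chart [c]: on the component above its
    domain, [D] is a single translate of [c.2 \o p], which makes sense at the
    points outside [E] as well. *)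
Lemma regular_extension (M Mt E : topologicalType) (AM : set (chart X M))
    (p : Mt -> M) (j : E -> Mt) (D : E -> X) x0 :
  (forall c, AM c -> is_chart c) ->
  locally_connected M -> locally_connected Mt -> continuous p ->
  embedding j -> portly (range j) -> (forall e, open_at (p \o j) e) ->
  (forall e, atlas_domain AM ((p \o j) e)) -> develops act AM (p \o j) D ->
  atlas_domain AM (p x0) ->
  extends_near j D x0.
Proof.
move=> chM lM lMt cp ej pj oq regM DM [c Ac cx0].
have [oc _ _ _] := chM _ Ac.
have [W [[oW Wx0] cW Wc]] := lM _ _ (open_nbhs_nbhs (conj oc cx0)).
set C := connected_component (p @^-1` W) x0.
have oC : open C by apply: open_connected_component => //; exact: open_comp.
have CW x : C x -> c.1 (p x) by move=> /connected_component_sub/Wc.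
have cj := embedding_continuous ej.
have cq : continuous (p \o j).
  by move=> e; apply: continuous_comp; [exact: cj|exact: cp].
have ccp x : C x -> {for x, continuous (c.2 \o p)}.
  move=> Cx; apply: continuous_comp; first exact: cp.
  by apply: open_homeo_on_continuous (chM _ Ac) _; exact: CW.
have cC : connected (j @^-1` C).
  by apply: portly_range_preimage => //; exact: component_connected.
have [g gP] : exists g, forall e, (j @^-1` C) e ->
    D e = act g ((c.2 \o (p \o j)) e).
  apply: (rigidity hGX (W := setT)); rewrite ?setIT //.
  - exact: subset_closure.
  - by move=> e Ce; apply: continuous_comp (ccp _ Ce); exact: cj.
  - by move=> e _; exact: (develops_continuous hGX chM (@cq e) (regM e) DM).
  - move=> e Ce; apply: open_at_comp; first exact: oq.
    by apply: open_homeo_on_open_at (chM _ Ac) _; exact: CW.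
  - by move=> e Ce; apply: DM => //; exact: CW.
exists C, (act g \o (c.2 \o p)); split.
- by split=> //; apply: connected_component_refl.
- move=> x Cx; apply: continuous_comp; first exact: ccp.
  exact: (an_continuous hGX).
- by move=> e Ce; rewrite gP.
Qed.

(** Trades the isomorphism between the subspaces [U] and [V] for a map between the
    ambient spaces, constant outside [U], and the portly subsets of the subspace
    [U] for portly subsets relative to the open set [U]. *)
Lemma isomorphism_on_open (M N : topologicalType) (AM : set (chart X M))
    (AN : set (chart X N)) (U : set M) (V : set N) (h : U -> V) m0 :
  open U -> open V -> U m0 ->
  ae_isomorphism act (restrict_atlas U AM) (restrict_atlas V AN) h ->
  exists (k : M -> N) (U0 : set M),
    [/\ open_homeo_on U k, open U0, U0 `<=` U, U `<=` closure U0 &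
      [/\ forall W, open W -> W `<=` U -> connected W -> connected (W `&` U0),
        forall x, U0 x -> atlas_domain AN (k x) &
        forall x c d, U0 x -> AM c -> c.1 x -> AN d -> d.1 (k x) ->
          exists g, \forall y \near x, d.2 (k y) = act g (c.2 y)]].
Proof.
move=> oU oV Um0 [[ch [h' [hK h'K ch']]] [_ [P [Q [pP _ _ QN [PQ gxP]]]]]].
have [oP dP cP] := pP.
have eU := @set_val_embedding M U.
have oUv := set_val_open_at oU.
have oval (W : set M) : open W -> open (set_val @^-1` W : set U).
  by move=> oW; apply/(eU.2 _); exists W.
have valU m (Um : U m) : exists u : U, set_val u = m.
  by exists (SigSub (mem_set Um)).
pose u0 : U := SigSub (mem_set Um0).
pose k m := set_val (h (xget u0 [set u : U | set_val u = m])).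
have kE u : k (set_val u) = set_val (h u).
  rewrite /k; case: xgetP => [v _ /eU.1 -> //|/(_ u)].
  by move=> /(_ erefl).
have ck m : U m -> {for m, continuous k}.
  move=> Um; have [u um] := valU m Um; rewrite -um => B nB.
  rewrite kE in nB.
  have nu : nbhs u [set v | B (set_val (h v))].
    have : {for u, continuous (set_val \o h)}.
      apply: continuous_comp; first exact: ch.
      exact: (embedding_continuous (@set_val_embedding N V)).
    exact.
  by apply: filterS (oUv _ _ nu) => _ [v Bv <-]; rewrite /preimage /= kE.
have ok (u : U) : open_at (k \o set_val) u.
  have -> : k \o set_val = set_val \o h by apply/funext; exact: kE.
  apply: open_at_comp; last exact: set_val_open_at.
  move=> B nB; have : nbhs (h u) (h' @^-1` B) by apply: ch'; rewrite hK.
  by apply: filterS => v Bv; exists (h' v).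
exists k, (set_val @` P); split.
- split=> //.
  + apply/subspace_continuousP => m Um; apply: cvg_within_filter; exact: ck.
  + move=> m n; rewrite !inE => Um Un.
    have [u <-] := valU m Um; have [v <-] := valU n Un.
    by rewrite !kE => /val_inj/(can_inj hK) ->.
  + move=> W oW WU; rewrite openE => _ [m Wm <-].
    have [u um] := valU m (WU _ Wm); rewrite -um.
    have nW : nbhs u (set_val @^-1` W).
      apply: (embedding_continuous eU); rewrite um.
      exact: open_nbhs_nbhs.
    by apply: filterS (ok _ _ nW) => _ [v Wv <-]; exists (set_val v).
- rewrite openE => _ [u Pu <-]; apply: oUv; exact: open_nbhs_nbhs.
- by move=> _ [u _ <-]; exact: set_valP.
- move=> m Um A; rewrite nbhsE => -[O [oO Om] OA].
  have [u um] := valU m Um.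
  have Ou : (set_val @^-1` O : set U) !=set0 by exists u; rewrite /= um.
  have [v [Ov Pv]] := dP _ Ou (oval _ oO).
  by exists (set_val v); split; [exists v|exact: OA].
split.
- move=> W oW WU cW.
  have -> : W `&` set_val @` P = set_val @` (set_val @^-1` W `&` P).
    apply/seteqP; split=> [m [Wm [v Pv vm]]|_ [v [Wv Pv] <-]].
      by exists v; rewrite // /preimage /= vm.
    by split=> //; exists v.
  apply: image_connected; first by move=> *; exact: (embedding_continuous eU).
  apply: cP.
  + exact: oval.
  + by apply: embedding_preimage_connected => //; rewrite range_set_val.
- move=> _ [u Pu <-]; rewrite kE.
  have [_ [d Ad <-] dhu] := QN _ (PQ _ Pu).
  by exists d.
- move=> _ c d [u Pu <-] Ac cu Ad; rewrite kE => du.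
  have [||g gP] := gxP u (set_val @^-1` c.1, c.2 \o set_val)
    (set_val @^-1` d.1, d.2 \o set_val) Pu _ cu _ du.
  + by exists c.
  + by exists d.
  exists g; apply: filterS (oUv _ _ gP) => _ [v [_ _ dv] <-].
  by rewrite kE.
Qed.

(** Everything the construction needs of the covering inside a branched cover. It
    is locally path connected because it embeds as an open subset of [Mt]. *)
Lemma branched_cover_facts (M : singular_manifold R act) (S : set M)
    (Mt : branched_cover S) : open (~` S) ->
  exists (E : topologicalType) (j : E -> Mt),
   [/\ simply_connected R E, locally_path_connected R E &
       locally_connected E] /\
   (embedding j /\ portly (range j)) /\
   [/\ forall e, (~` S) (bc_proj Mt (j e)),
       forall e, open_at (bc_proj Mt \o j) e,
       forall m, (~` S) m -> exists e, (bc_proj Mt \o j) e = m &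
     forall m, (~` S) m ->
       exists2 O, open_nbhs m O & forall e, O ((bc_proj Mt \o j) e) ->
         exists s : M -> E, [/\ forall n, O n -> {for n, continuous s},
           forall n, O n -> (bc_proj Mt \o j) (s n) = n,
           s ((bc_proj Mt \o j) e) = e &
           \forall x \near e, s ((bc_proj Mt \o j) x) = x]].
Proof.
move=> oS; have [E [pi [j [[cpi scE] [_ ej pj pjr]]]]] := bc_universal Mt.
exists E, j.
have qE : bc_proj Mt \o j = set_val \o pi by apply/funext.
have [orj _ _] := pjr.
have [_ lMt _] := bc_admissible Mt.
have lE := lpc_embedding ej orj lMt.
split; first by split=> //; exact: lpc_locally_connected lE.
split=> //; rewrite qE; split.
- by move=> e; rewrite -[bc_proj _ _]/((bc_proj Mt \o j) e) pj; exact: set_valP.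
- exact: covering_open_at.
- exact: covering_surjective.
- exact: covering_section.
Qed.

End BranchedCovers.

Theorem proposition3p20 (R : realType) (X : topologicalType) (G : groupType)
    (act : G -> X -> X) (hGX : analytical_structure R act)
    (A : Type) (XA : A -> singular_manifold R act)
    (hXA : forall a, model_space (XA a))
    (XAt : forall a, branched_cover (Sing (XA a)))
    (hdev : forall a, admits_developing_map (XAt a))
    (M : singular_manifold R act) (hMconn : connected [set: M])
    (hM : modelled_on XA M)
    (hMreg : semi_locally_simply_connected R (set_type (Reg M)))
    (S : set M) (hS : skeletal S) (hSing : Sing M `<=` S)
    (hMS : semi_locally_simply_connected R (set_type (~` S)))
    (Mt : branched_cover S) :
  admits_developing_map Mt.
Proof.
have [oS _ _] := hS.
have [E [j [[scE lpE lcE] [[ej pj] [Sq oq _ sq]]]]] :=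
  branched_cover_facts Mt oS.
have [orj drj _] := pj.
set p := bc_proj Mt in Sq oq sq *.
have [ae _] := sm_maximal M; have [chM _ _] := ae.
have regM e : atlas_domain (sm_atlas M) ((p \o j) e).
  by apply: contrapT => /hSing; exact: Sq.
have [hX _ _] := an_admissible hGX.
have [_ _ fcM] := sm_admissible M.
have lcM := @sm_locally_connected _ _ _ _ M.
have lcMt : locally_connected Mt.
  by have [_ l _] := bc_admissible Mt; exact: lpc_locally_connected l.
have [cp [U2 [V2 [pU2 U2T pV2 V2M [UV2 gxp]]]]] := bc_morphism Mt.
have cq : continuous (p \o j).
  move=> e; apply: continuous_comp; last exact: cp.
  exact: embedding_continuous.
have [D DM] := developing_map_simply_connected hGX ae scE lpE cq oq regM.
have [D' cD' D'j] : exists2 D' : Mt -> X, continuous D' & D' \o j =1 D.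
  apply: extension_glue => // x0.
  have [regx|singx] := pselect (Reg M (p x0)).
    exact: (regular_extension hGX chM lcM lcMt cp ej pj oq regM DM).
  have [U [oU Ux] [a [y [V [h [Vs [oV Vy] iso]]]]]] := hM _ singx.
  have [k [U0 [hk oU0 U0U U0d [U0c regN hgx]]]] :=
    isomorphism_on_open oU oV Ux iso.
  have [aeN _] := sm_maximal (XA a); have [chN _ [oN _ _]] := aeN.
  have SN : ~` Sing (XA a) = Reg (XA a) by rewrite /Sing setCK.
  have oSN : open (~` Sing (XA a)) by rewrite SN.
  have [F [jn [[_ _ lcF] [[ejn pjn] [_ oqn surjn sn]]]]] :=
    branched_cover_facts (XAt a) oSN.
  rewrite SN in surjn sn.
  have [Dn [cDn Dn']] := hdev a.
  have [orjn _ _] := pjn.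
  have DN := develops_cover hGX aeN lcF ejn orjn oqn (bc_morphism (XAt a))
    (conj cDn Dn').
  have [hN _ _] := sm_admissible (XA a).
  have csN : complete_spread (bc_proj (XAt a)).
    by have [? [? [? [_ []]]]] := bc_universal (XAt a).
  apply: (singular_extension hGX fcM lcM lcMt lcE cp ej pj oq _ chM regM DM
    hN (@sm_locally_connected _ _ _ _ (XA a)) csN (embedding_continuous ejn)
    cDn chN DN surjn _ hk oU0 U0U U0d U0c regN hgx Ux).
    move=> e; have [O oO sO] := sq _ (Sq e).
    exists O => //.
    by have [|s [? ? ? ?]] := sO e; [have [] := oO|exists s].
  move=> n /sn[O oO sO]; exists O => // e /sO[s [? ? ? _]].
  by exists s.
(* on the portly set [U2 `&` range j] both the projection and [D] are
   expressed in the charts of [M] *)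
exists D'; split=> //; exists (U2 `&` range j), setT; split.
- exact: portlyI.
- by move=> x [/U2T].
- exact: portly_setT.
- by move=> x _; exists ([set: X], idfun).
split=> // x c _ [U2x [e _ ex]] Ac cx -> _.
have [d Ad dx] := V2M _ (UV2 _ U2x).
have [g gP] := gxp _ _ _ U2x Ac cx Ad dx.
rewrite -ex in dx; have [l lP] := DM _ _ Ad dx.
exists (l * g)%g.
have := embedding_open_at ej orj lP; rewrite ex => lP'.
apply: (filterS2 _ _ gP lP') => y [cy _ dy] [e' le' ey]; split=> //.
have D'y : D' y = D e' by rewrite -ey; exact: D'j.
by rewrite D'y le' /= ey dy (an_actM hGX).
Qed.
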